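(* Let $f(x,y)>0$ be a real symmetric function (i.e. $f(x,y)=f(y,x)$) which is increasing and convex in the variable $x$ (i.e. $f'_x(x,y)\ge 0$ and $f''_x(x,y)\ge 0$), and which satisfies $f(x_1,y_1)\ge f(x_2,y_2)$ whenever $x_1+y_1=x_2+y_2$ and $|x_1-y_1|>|x_2-y_2|$. Among all trees of order $n$, the path $P_n$ is the unique tree with the smallest spectral radius of $A_f(T)$, and the star $S_n$ is the unique tree with the largest spectral radius of $A_f(T)$.
   Context: For a graph $G$ with vertex set $\{v_1,\dots,v_n\}$, $d_i$ denotes the degree of $v_i$. The weighted adjacency matrix $A_f(G)$ is the $n\times n$ matrix whose $(i,j)$-entry is $f(d_i,d_j)$ if $v_iv_j$ is an edge of $G$ and $0$ otherwise. When $f$ satisfies all the hypotheses in the claim, $A_f(G)$ is called the restrictedly weighted adjacency matrix of $G$. The spectral radius $\rho(M)$ of a matrix $M$ is the maximum modulus of its eigenvalues. $P_n$ and $S_n$ denote the path and the star on $n$ vertices. *)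

(* Defs.v *)
From HB Require Import structures.
From mathcomp Require Export all_boot all_order all_algebra perm.
From mathcomp Require Export complex.
From mathcomp Require Export all_classical all_reals all_analysis.
Export Order.TTheory GRing.Theory Num.Theory.
Export numFieldNormedType.Exports.

Set Implicit Arguments.
Unset Strict Implicit.
Unset Printing Implicit Defensive.

Local Open Scope ring_scope.

Record sgraph (n : nat) := SGraph {
  adj :> rel 'I_n;
  adj_sym : symmetric adj;
  adj_irr : irreflexive adj
}.

Definition degree n (G : sgraph n) (i : 'I_n) : nat := #|[set j | G i j]|.

Definition connected_graph n (G : sgraph n) : Prop :=
  (0 < n)%N /\ forall i j : 'I_n, connect G i j.

(* A cyclic sequence of length 2 (an edge traversed back and forth) is
   accepted by [ucycle], hence the length condition. *)
Definition acyclic_graph n (G : sgraph n) : Prop :=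
  forall p : seq 'I_n, (2 < size p)%N -> ~ ucycle G p.

Definition is_tree n (G : sgraph n) : Prop :=
  connected_graph G /\ acyclic_graph G.

Definition isomorphic n (G H : sgraph n) : Prop :=
  exists s : 'S_n, forall i j, H (s i) (s j) = G i j.

Definition path_rel n : rel 'I_n :=
  fun i j => (i.+1 == j :> nat) || (j.+1 == i :> nat).

Lemma path_rel_sym n : symmetric (@path_rel n).
Proof. by move=> i j; rewrite /path_rel orbC. Qed.

Lemma path_rel_irr n : irreflexive (@path_rel n).
Proof. by move=> i; rewrite /path_rel orbb gtn_eqF. Qed.

Definition path_graph n : sgraph n :=
  SGraph (@path_rel_sym n) (@path_rel_irr n).

Definition star_rel n : rel 'I_n :=
  fun i j => (i != j) && ((i == 0 :> nat) || (j == 0 :> nat)).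

Lemma star_rel_sym n : symmetric (@star_rel n).
Proof. by move=> i j; rewrite /star_rel eq_sym orbC. Qed.

Lemma star_rel_irr n : irreflexive (@star_rel n).
Proof. by move=> i; rewrite /star_rel eqxx. Qed.

Definition star_graph n : sgraph n :=
  SGraph (@star_rel_sym n) (@star_rel_irr n).

Definition weighted_adj (R : realType) (f : R -> R -> R) n (G : sgraph n) :
    'M[R]_n :=
  \matrix_(i, j) if G i j then f (degree G i)%:R (degree G j)%:R else 0.

(* The eigenvalues are taken in R[i]. Their set is finite, and nonempty for
   0 < n, so that the supremum of the moduli is a maximum. *)
Definition spectral_radius (R : realType) n (A : 'M[R]_n) : R :=
  sup [set ComplexField.Normc.normc z |
        z in [set z : R[i] | eigenvalue (map_mx (real_complex R) A) z]]%classic.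

(* Degrees of adjacent vertices are at least 1, so f is only constrained on
   [1, +oo[ x [1, +oo[. *)
Record restricted_weight (R : realType) (f : R -> R -> R) : Prop := {
  weight_gt0 : forall x y, 1 <= x -> 1 <= y -> 0 < f x y;
  weight_sym : forall x y, 1 <= x -> 1 <= y -> f x y = f y x;
  weight_derivable : forall x y, 1 <= x -> 1 <= y ->
    derivable (f^~ y) x 1;
  weight_increasing : forall x y, 1 <= x -> 1 <= y ->
    0 <= derive1 (f^~ y) x;
  weight_derivable2 : forall x y, 1 <= x -> 1 <= y ->
    derivable (derive1 (f^~ y)) x 1;
  weight_convex : forall x y, 1 <= x -> 1 <= y ->
    0 <= derive1 (derive1 (f^~ y)) x;
  weight_spread : forall x1 y1 x2 y2,
    1 <= x1 -> 1 <= y1 -> 1 <= x2 -> 1 <= y2 ->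
    x1 + y1 = x2 + y2 -> `|x1 - y1| > `|x2 - y2| -> f x1 y1 >= f x2 y2
}.

(* Main.v *)
(* By Rayleigh's principle, the spectral radius of a symmetric matrix bounds its
   quadratic form, with equality only at eigenvectors; for a connected graph it
   has a positive eigenvector.

   Star. Adjacent degrees in a tree satisfy d_i + d_j <= n, so every weight is
   at most w = f(1, n-1), and sum_(j ~ i) d_j <= n-1 bounds the row sums of the
   squared matrix by w^2 (n-1), the squared spectral radius of the star. In the
   equality case the neighbour of a leaf has degree n-1.

   Path. Put a = f(1,2) and b = f(2,2), so that rho(P_n) < 2b. A tree with a
   vertex of degree 4 or two vertices of degree 3 has rho >= 2b, by the test
   vector of the affine Dynkin diagrams D~. The remaining trees other than P_n
   are spiders with legs of lengths p, q, r, where p <= r. Reading a spider along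
   [leg p][leg q][centre][leg r] as v_0 ... v_m, it arises from P_n by replacing
   the edge v_(p-1) v_p by v_(p-1) v_(p+q); evaluating its quadratic form at the
   symmetric unimodal Perron vector of P_n does not decrease it, the loss b - a
   at the new leaf v_p being repaid by f(2,3) - b >= b - a (convexity). The Perron
   vector of P_n is not an eigenvector of the spider, hence the strictness. *)
Require Import Defs.
From mathcomp Require Import sesquilinear spectral.
From mathcomp Require Import zify ring lra.
Set Implicit Arguments.
Unset Strict Implicit.
Unset Printing Implicit Defensive.
Local Open Scope ring_scope.

(** * Rayleigh's principle and Perron vectors *)

Section Spectrum.
Variables (R : realType) (n : nat).
Implicit Type A : 'M[R]_n.

Local Notation toC := (real_complex R).
Local Notation normc := ComplexField.Normc.normc.
Local Open Scope sesquilinear_scope.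

(** Over [R[i]] the characteristic polynomial splits, so the eigenvalues form the finite nonempty
    list [r] of its roots, and the supremum is reached at the entry of largest modulus. *)
Lemma spectral_radius_attained A : (0 < n)%N ->
  (exists2 z, eigenvalue (map_mx toC A) z & normc z = spectral_radius A) /\
  forall z, eigenvalue (map_mx toC A) z -> normc z <= spectral_radius A.
Proof.
move=> n_gt0; set B := map_mx toC A.
have [r Er] := closed_field_poly_normal (char_poly B).
have memr z : eigenvalue B z = (z \in r).
  by rewrite eigenvalue_root_char Er (monicP (char_poly_monic _)) scale1r
             root_prod_XsubC.
have [z0 /[!memr] z0r] := eigenvalue_closed B n_gt0.
have [i0 _ maxi0] := @Order.TotalTheory.arg_maxP _ _ _
  (Ordinal (etrans (index_mem z0 r) z0r)) xpredT (fun i : 'I_(size r) => normc r`_i) isT.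
have maxz z : eigenvalue B z -> normc z <= normc r`_i0.
  rewrite memr => /(nthP 0)[i ir <-].
  exact: (maxi0 (Ordinal ir)).
have Ei0 : eigenvalue B r`_i0 by rewrite memr mem_nth.
have Erho : spectral_radius A = normc r`_i0.
  apply/eqP; rewrite eq_le; apply/andP; split.
    apply: ge_sup; first by exists (normc r`_i0), r`_i0.
    by move=> _ [z /= Bz <-]; exact: maxz.
  apply: ub_le_sup; last by exists r`_i0.
  by exists (normc r`_i0) => _ [z /= Bz <-]; exact: maxz.
by split; [exists r`_i0 | rewrite Erho].
Qed.

Lemma normcE_toC (z : R[i]) : `|z| = toC (normc z).
Proof. by []. Qed.

Lemma conj_real_complex (a : R) : (toC a)^* = toC a.
Proof. by apply/CrealP; rewrite complex_real. Qed.

(** The spectral theorem gives a unitary eigenbasis [P] with real eigenvalues [d]; in the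
    coordinates [z] the gap in Rayleigh's inequality is a sum of nonnegative terms. Both the
    inequality and its equality case are read off from it. *)
Lemma rayleigh_decomp A (x : 'rV[R]_n) : A^T = A -> (0 < n)%N ->
  exists P : 'M[R[i]]_n, exists d : 'rV[R]_n, exists z : 'rV[R[i]]_n,
  [/\ map_mx toC x = z *m P,
   z *m diag_mx (map_mx toC d) *m P = map_mx toC (x *m A),
   forall i, d 0 i <= spectral_radius A &
   toC (spectral_radius A * (x *m x^T) 0 0 - (x *m A *m x^T) 0 0) =
     \sum_i toC (spectral_radius A - d 0 i) * `|z 0 i| ^+ 2].
Proof.
move=> symA n_gt0; set B := map_mx toC A.
have hermB : B \is hermsymmx.
  apply/is_hermitianmxP; rewrite expr0 scale1r /B map_trmx symA.
  by rewrite -map_mx_comp; apply: eq_map_mx => a /=; rewrite conj_real_complex.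
have /hermitian_normalmx/orthomx_spectralP := hermB.
have := hermitian_spectral_diag_real hermB.
have := spectral_unitarymx B.
move: (spectralmx B) (spectral_diag B) => P d0 unitP reald EB.
have unP := unitarymx_unit unitP.
pose d : 'rV[R]_n := map_mx (@complex.Re R) d0.
have Ed : d0 = map_mx toC d.
  apply/rowP => i; rewrite !mxE /=.
  by have /mxOverP/(_ 0 i)/RRe_real-> := reald.
pose z := map_mx toC x *m invmx P.
have Ez : map_mx toC x = z *m P by rewrite mulmxKV.
have Exz : (map_mx toC x)^T = P^t* *m z^t*.
  have -> : (map_mx toC x)^T = (map_mx toC x)^t*.
    rewrite map_trmx -map_mx_comp; apply: eq_map_mx => a /=.
    by rewrite conj_real_complex.
  by rewrite Ez trmx_mul map_mxM.
have EA : z *m diag_mx (map_mx toC d) *m P = map_mx toC (x *m A).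
  by rewrite map_mxM -/B EB Ed !mulmxA.
have PPt : P *m P^t* = 1%:M by apply/unitarymxP.
exists P, d, z; split => // [i|].
  have Bd : eigenvalue B (toC (d 0 i)).
    apply/eigenvalueP; exists (row i P).
      rewrite EB Ed -row_mul !mulmxA mulmxV // mul1mx.
      by rewrite mul_diag_mx; apply/rowP => j; rewrite !mxE.
    apply/eqP => /(congr1 (mulmx^~ (invmx P))); rewrite -row_mul mulmxV // mul0mx.
    by move=> /rowP/(_ i)/eqP; rewrite !mxE eqxx oner_eq0.
  apply: le_trans (ler_norm _) _.
  have := (spectral_radius_attained A n_gt0).2 _ Bd.
  by rewrite /ComplexField.Normc.normc /= expr0n /= addr0 sqrtr_sqr.
rewrite rmorphB rmorphM /=.
have toC00 (M : 'M[R]_1) : toC (M 0 0) = map_mx toC M 0 0 by rewrite mxE.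
rewrite 2!toC00 (map_mxM _ x) (map_mxM _ (x *m A)) -EA -map_trmx Exz Ez !mulmxA.
rewrite -(mulmxA _ P) PPt mulmx1 -(mulmxA _ P) PPt mulmx1.
rewrite mul_mx_diag !mxE mulr_sumr -sumrB; apply: eq_bigr => i _.
rewrite !mxE rmorphB mulrBl normCK mulrA; congr (_ - _).
by rewrite mulrAC mulrC mulrA.
Qed.

Lemma rayleigh A (x : 'rV[R]_n) : A^T = A -> (0 < n)%N ->
  (x *m A *m x^T) 0 0 <= spectral_radius A * (x *m x^T) 0 0.
Proof.
move=> symA n_gt0; have [P [d [z [_ _ led E]]]] := rayleigh_decomp x symA n_gt0.
rewrite -subr_ge0 -lecR E; apply: sumr_ge0 => i _.
by rewrite mulr_ge0 ?exprn_ge0 // lecR subr_ge0.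
Qed.

Lemma rayleigh_eq A (x : 'rV[R]_n) : A^T = A -> (0 < n)%N ->
  spectral_radius A * (x *m x^T) 0 0 <= (x *m A *m x^T) 0 0 ->
  x *m A = spectral_radius A *: x.
Proof.
move=> symA n_gt0 lex.
have [P [d [z [Ex EA led E]]]] := rayleigh_decomp x symA n_gt0.
have /eqP := E.
have -> : spectral_radius A * (x *m x^T) 0 0 - (x *m A *m x^T) 0 0 = 0.
  by apply/eqP; rewrite subr_eq0 eq_le lex rayleigh.
rewrite rmorph0 eq_sym psumr_eq0; last first.
  by move=> i _; rewrite mulr_ge0 ?exprn_ge0 // lecR subr_ge0.
(* Every term of the gap vanishes, so [z] is supported on the coordinates whose eigenvalue is the
   spectral radius. *)
move=> /allP/(_ _ (mem_index_enum _)) E0.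
have inj : injective (map_mx toC : 'rV[R]_n -> _) by apply: map_mx_inj.
apply: inj; rewrite map_mxZ -EA Ex scalemxAl; congr (_ *m _).
apply/rowP => i; rewrite mul_mx_diag !mxE.
have := E0 i; rewrite mulf_eq0 expf_eq0 normr_eq0 /=.
case/orP=> [|/eqP->]; last by rewrite mul0r mulr0.
by rewrite fmorph_eq0 subr_eq0 => /eqP ->; rewrite mulrC.
Qed.

(** Take the moduli of an eigenvector whose eigenvalue has maximal modulus. The triangle inequality
    gives [rho x <= x A] entrywise; pairing with [x] reaches equality in Rayleigh's inequality, so
    [x] is an eigenvector. *)
Lemma perron A : A^T = A -> (0 < n)%N -> (forall i j, 0 <= A i j) ->
  exists x : 'rV[R]_n, [/\ forall i, 0 <= x 0 i, x != 0 &
    x *m A = spectral_radius A *: x].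
Proof.
move=> symA n_gt0 A_ge0.
have [[z /eigenvalueP[v Ev v0] Ez] _] := spectral_radius_attained A n_gt0.
pose x : 'rV[R]_n := \row_i normc (v 0 i).
have x_ge0 i : 0 <= x 0 i by rewrite mxE -lecR; exact: normr_ge0 (v 0 i).
exists x; split => //.
  apply: contraNneq v0 => x0; apply/eqP/rowP => i.
  rewrite [RHS]mxE; apply: ComplexField.Normc.eq0_normc.
  by move/rowP/(_ i): x0; rewrite !mxE.
have subA i : spectral_radius A * x 0 i <= (x *m A) 0 i.
  rewrite -lecR rmorphM /= -Ez mxE -!normcE_toC -normrM.
  have := congr1 (fun u : 'rV_n => u 0 i) Ev; rewrite !mxE => <-.
  apply: le_trans (ler_norm_sum _ _ _) _.
  rewrite rmorph_sum; apply: ler_sum => j _.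
  rewrite !mxE normrM rmorphM /= -normcE_toC.
  by rewrite (ger0_norm (x := toC _)) // lecR.
apply: rayleigh_eq => //; rewrite [in leLHS]mxE [leRHS]mxE mulr_sumr.
apply: ler_sum => i _; rewrite mulrA [x^T _ _]mxE.
exact: ler_wpM2r.
Qed.

Lemma rV_sqr_gt0 (x : 'rV[R]_n) : x != 0 -> 0 < (x *m x^T) 0 0.
Proof.
move=> /rV0Pn[i xi]; rewrite mxE (bigD1 i) //= mxE -expr2 ltr_pwDl //.
  by rewrite exprn_even_gt0.
by apply: sumr_ge0 => j _; rewrite mxE -expr2 sqr_ge0.
Qed.

Lemma spectral_radius_ge A (x : 'rV[R]_n) c : A^T = A -> (0 < n)%N ->
  x != 0 -> c * (x *m x^T) 0 0 <= (x *m A *m x^T) 0 0 -> c <= spectral_radius A.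
Proof.
move=> symA n_gt0 x0 /le_trans/(_ (rayleigh x symA n_gt0)).
rewrite ler_pM2r //; exact: rV_sqr_gt0.
Qed.

Lemma spectral_radius_ge_sub A (x : 'rV[R]_n) c : A^T = A -> (0 < n)%N ->
  x != 0 -> (forall i, 0 <= x 0 i) -> (forall i, c * x 0 i <= (x *m A) 0 i) ->
  c <= spectral_radius A.
Proof.
move=> symA n_gt0 x0 x_ge0 subA; apply: (spectral_radius_ge (x := x)) => //.
rewrite [in leLHS]mxE [leRHS]mxE mulr_sumr; apply: ler_sum => i _.
by rewrite mulrA [x^T _ _]mxE ler_wpM2r.
Qed.

End Spectrum.

(** * The weight function *)

Section Weight.
Variables (R : realType) (f : R -> R -> R).
Hypothesis wf : restricted_weight f.

Lemma weight_nondecreasing_l x x' y : 1 <= y -> 1 <= x -> x <= x' ->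
  f x y <= f x' y.
Proof.
move=> y1 x1 xx'; apply: (@ger0_derive1_ndecry _ (f^~ y) 1) => //.
- by move=> t /[!in_itv] /= /andP[/ltW t1 _]; exact: weight_derivable.
- by move=> t /[!in_itv] /= /andP[/ltW t1 _]; exact: weight_increasing.
- apply: derivable_within_continuous => t /[!in_itv] /= /andP[t1 _].
  exact: weight_derivable.
Qed.

Lemma weight_nondecreasing x x' y y' : 1 <= x -> 1 <= y -> x <= x' -> y <= y' ->
  f x y <= f x' y'.
Proof.
move=> x1 y1 xx' yy'; have x'1 := le_trans x1 xx'.
apply: le_trans (weight_nondecreasing_l y1 x1 xx') _.
rewrite (weight_sym wf x'1 y1) (weight_sym wf x'1 (le_trans y1 yy')).
exact: weight_nondecreasing_l.
Qed.

(** By the mean value theorem the two increments are values of the derivative at points of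
    consecutive unit intervals, and convexity makes the derivative nondecreasing. *)
Lemma weight_secant x y : 1 <= x -> 1 <= y ->
  f (x + 1) y - f x y <= f (x + 2) y - f (x + 1) y.
Proof.
move=> x1 y1.
have D (t : R) : 1 <= t -> is_derive t 1 (f^~ y) (derive1 (f^~ y) t).
  by move=> t1; rewrite derive1E; apply/derivableP/weight_derivable.
have mvt a : 1 <= a -> exists2 c, c \in `]a, a + 1[ &
    f (a + 1) y - f a y = (derive1 (f^~ y)) c.
  move=> a1; have [|t /[!in_itv] /= /andP[/ltW/(le_trans a1) t1 _]||c ca ->] :=
    @MVT _ (f^~ y) (derive1 (f^~ y)) a (a + 1); rewrite ?ltrDl //; last 2 first.
  - apply: derivable_within_continuous => t /[!in_itv] /= /andP[/(le_trans a1) t1 _].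
    exact: weight_derivable.
  - by exists c => //; rewrite addrAC subrr add0r mulr1.
  exact: D.
have [c cx ->] := mvt x x1.
have [|c' cx' E] := mvt (x + 1); first lra.
have -> : x + 2 = x + 1 + 1 by ring.
move: cx cx'; rewrite E !in_itv /= => /andP[xc cx] /andP[xc' c'x].
apply: (@ger0_derive1_ndecry _ (derive1 (f^~ y)) 1); last by lra.
- by move=> t /[!in_itv] /= /andP[/ltW t1 _]; exact: weight_derivable2.
- by move=> t /[!in_itv] /= /andP[/ltW t1 _]; exact: weight_convex.
- apply: derivable_within_continuous => t /[!in_itv] /= /andP[t1 _].
  exact: weight_derivable2.
- by lra.
Qed.

Lemma weight12_le22 : f 1 2 <= f 2 2.
Proof. by apply: weight_nondecreasing; lra. Qed.

Lemma weight22_le13 : f 2 2 <= f 1 3.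
Proof. by apply: weight_spread => //; rewrite ?subrr ?normr0; try lra; rewrite ltr0_norm; lra. Qed.

Lemma weight23_ge : f 2 2 + (f 2 2 - f 1 2) <= f 2 3.
Proof.
have := @weight_secant 1 2; rewrite (weight_sym wf (_ : 1 <= 2) (_ : 1 <= 3)); lra.
Qed.

(** Monotonicity raises [e] to [m.+1 - d]. Then the arguments have the same sum as [1] and [m], and
    the spread hypothesis applies, except for [d = 1] and [d = m], where the spreads coincide and
    the weights are equal. *)
Lemma weight_star_ge (m d e : nat) : (0 < d)%N -> (0 < e)%N -> (d + e <= m.+1)%N ->
  f d%:R e%:R <= f 1 m%:R.
Proof.
move=> d0 e0 dem.
have [m0|m_gt0] := posnP m; first by lia.
have h : (d <= m)%N by lia.
have m1 : 1 <= m%:R :> R by rewrite ler1n.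
have d1 : 1 <= d%:R :> R by rewrite ler1n.
have e1 : 1 <= e%:R :> R by rewrite ler1n.
have Em : (m.+1 - d)%:R = m%:R + 1 - d%:R :> R by rewrite natrB ?natr1 // leqW.
apply: (@le_trans _ _ (f d%:R (m.+1 - d)%:R)).
  by apply: weight_nondecreasing => //; rewrite ler_nat; lia.
have [->|d_neq1] := eqVneq d 1%N; first by rewrite subSS subn0.
have [->|d_neqm] := eqVneq d m; first by rewrite subSnn weight_sym.
have dm : d%:R + 1 <= m%:R :> R by rewrite natr1 ler_nat; lia.
have d2 : 2 <= d%:R :> R by rewrite ler_nat; lia.
apply: weight_spread => //; rewrite ?Em; try lra.
rewrite [ltRHS]ltr0_norm; last lra.
by rewrite ltr_norml; apply/andP; split; lra.
Qed.

End Weight.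

(** * Paths in trees *)

Section Graphs.
Variables (n : nat) (G : sgraph n).
Implicit Types (u v c : 'I_n) (s t : seq 'I_n).

Lemma size_le_degree v s : uniq s -> all (G v) s -> (size s <= degree G v)%N.
Proof.
move=> us /allP Gs; rewrite /degree cardE; apply: uniq_leq_size => // u /Gs Gvu.
by rewrite mem_enum inE.
Qed.

Lemma degree_gt0 u v : G u v -> (0 < degree G u)%N.
Proof. by move=> Guv; apply: (@size_le_degree u [:: v]) => //=; rewrite Guv. Qed.

Lemma connected_closed (S : pred 'I_n) u v : connected_graph G ->
  (forall x y, G x y -> S x -> S y) -> S u -> S v.
Proof.
move=> [_ cG] clS Su.
have csym := sym_connect_sym (@adj_sym _ G).
have clG : closed_mem G (mem S) by apply: intro_closed => // x y; exact: clS.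
by move: (closed_connect clG (cG u v)); rewrite !unfold_in Su => <-.
Qed.

Lemma path_uniq_size c s : uniq (c :: s) -> (size s < n)%N.
Proof. by move=> /card_uniqP/= <-; rewrite -[n in (_ <= n)%N]card_ord max_card. Qed.

(* Two simple paths leaving [c] through different neighbours can only meet
   again by closing a cycle. *)
Lemma acyclic_fork c s t : acyclic_graph G ->
  path G c s -> path G c t -> uniq (c :: s) -> uniq (c :: t) ->
  head c s != head c t -> ~~ has (mem s) t.
Proof.
move=> acG ps pt us ut neq; apply/negP => hit.
case: (split_find hit) pt ut neq => v t1 t2 /= vs nt1.
case: (splitPr vs) ps us nt1 => s1 s2 ps us nt1 pt ut neq.
(* Here [v] is the first vertex of [t] lying on [s]: the cycle follows [s] up to [v] and returns to
   [c] along [t]. *)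
apply: (acG (c :: s1 ++ v :: rev t1)); first last.
  apply/andP; split.
    rewrite /= rcons_cat cat_path /=.
    move: ps; rewrite cat_path /= => /and3P[-> -> _] /=.
    have := rev_path G c (rcons t1 v).
    rewrite last_rcons belast_rcons rev_cons => Erev.
    rewrite Erev (eq_path (e' := G)); last by move=> x y; rewrite adj_sym.
    by move: pt; rewrite cat_path => /andP[].
  move: us; rewrite -cat_rcons -cat_cons cat_uniq => /and3P[us1 _ _].
  move: ut; rewrite mem_cat cat_uniq negb_or => /andP[/andP[cnt _] /andP[ut1 _]].
  rewrite -cat_rcons -cat_cons cat_uniq us1 rev_uniq.
  move: ut1 cnt; rewrite rcons_uniq mem_rcons inE negb_or => /andP[vnt ut1] /andP[cv cnt].
  rewrite ut1 andbT /=; apply/hasPn => y; rewrite mem_rev => yt1.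
  rewrite inE mem_rcons inE !negb_or; apply/and3P; split.
  - by apply: contraNneq cnt => <-.
  - by apply: contraNneq vnt => <-.
  - by move/hasPn/(_ y yt1): nt1; rewrite /= mem_cat negb_or => /andP[].
(* The cycle has at least three vertices: if [s1] and [t1] were both empty, [v] would be the head of
   both paths. *)
rewrite /= size_cat /= size_rev.
by case: s1 {ps us nt1} neq => [|? ?]; case: t1 {pt ut} => [|? ?] //=; rewrite ?eqxx //; lia.
Qed.

(** Extend the path at its last vertex as long as possible; a simple path has at most [n] vertices,
    so this stops. *)
Lemma maximal_path c s : path G c s -> uniq (c :: s) ->
  exists t, [/\ path G c (s ++ t), uniq (c :: s ++ t) &
    forall u, G (last c (s ++ t)) u -> u \in c :: s ++ t].
Proof.
have [m] := ubnP (n - size s); elim: m s => // m IH s ltm ps us.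
have [/existsP[u /andP[Gu nu]]|none] :=
  boolP [exists u, G (last c s) u && (u \notin c :: s)].
  have [||| t [pt ut Et]] := IH (rcons s u).
  - by rewrite size_rcons; have := path_uniq_size us; lia.
  - by rewrite rcons_path ps.
  - by rewrite -rcons_cons rcons_uniq nu.
  by exists (u :: t); rewrite -cat_rcons.
exists [::]; rewrite cats0; split=> // u Gu.
by move/existsPn/(_ u): none; rewrite Gu negbK.
Qed.

(** The last vertex is covered by maximality. Any other vertex of [s] already has its predecessor
    and successor as neighbours, which exhausts degree 2. *)
Lemma maximal_path_closed c s v u : path G c s -> uniq (c :: s) ->
  (forall w, G (last c s) w -> w \in c :: s) ->
  v \in s -> (degree G v <= 2)%N -> G v u -> u \in c :: s.
Proof.
move=> + + + /splitPr Es; case: Es => s1 [|q s2].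
  by rewrite last_cat /= => _ _ mx _; exact: mx.
move=> ps us _ dv Gvu; move: ps; rewrite cat_path /= => /and4P[_ Gpv Gvq _].
apply: contraTT dv => nu; rewrite -ltnNge.
apply: (@size_le_degree v [:: last c s1; q; u]); last first.
  by rewrite /= Gvq Gvu adj_sym Gpv.
have pl : last c s1 \in c :: s1 by apply: mem_last.
have nq : q \notin c :: s1.
  move: us; rewrite -cat_cons cat_uniq => /and3P[_ /hasPn h _].
  by apply: (h q); rewrite !inE eqxx orbT.
rewrite /= !inE !negb_or !andbT; apply/andP; split.
  apply/andP; split; first by apply: contraNneq nq => <-.
  by apply: contraNneq nu => <-; rewrite -cat_cons mem_cat pl.
by apply: contraNneq nu => <-; rewrite -cat_cons mem_cat !inE eqxx !orbT.
Qed.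

Lemma maximal_path_cover c s : connected_graph G ->
  (forall v u, v \in s -> G v u -> u \in s) -> c \in s -> uniq s -> size s = n.
Proof.
move=> cG cl cs us; rewrite -(card_uniqP us) -[RHS]card_ord; apply: eq_card => v.
rewrite [RHS]inE; apply: (connected_closed (S := mem s)) cG _ cs.
by move=> x y Gxy xs; exact: cl Gxy.
Qed.

End Graphs.

(** * Weighted adjacency matrices and their positive eigenvectors *)

Section WeightedGraphs.
Variables (R : realType) (f : R -> R -> R) (n : nat) (G : sgraph n).
Hypothesis wf : restricted_weight f.

Lemma weighted_adj_sym : (weighted_adj f G)^T = weighted_adj f G.
Proof.
apply/matrixP => i j; rewrite !mxE adj_sym; case: ifP => // Gij.
by rewrite weight_sym // ler1n; [apply: (degree_gt0 (v := i)); rewrite adj_sym|exact: degree_gt0 Gij].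
Qed.

Lemma weighted_adj_ge (l1 l2 : nat) i j : G i j -> (0 < l1 <= degree G i)%N ->
  (0 < l2 <= degree G j)%N -> f l1%:R l2%:R <= weighted_adj f G i j.
Proof.
move=> Gij /andP[l1_gt0 l1d] /andP[l2_gt0 l2d]; rewrite mxE Gij.
by apply: weight_nondecreasing; rewrite // ?ler1n // ler_nat.
Qed.

Lemma weighted_adj_gt0 i j : G i j -> 0 < weighted_adj f G i j.
Proof.
move=> Gij; apply: (@lt_le_trans _ _ (f 1%:R 1%:R)); first exact: weight_gt0.
have Gji : G j i by rewrite adj_sym.
by apply: weighted_adj_ge => //; exact: degree_gt0 Gij || exact: degree_gt0 Gji.
Qed.

Lemma weighted_adj_ge0 i j : 0 <= weighted_adj f G i j.
Proof.
have [Gij|/negbTE nGij] := boolP (G i j); first exact/ltW/weighted_adj_gt0.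
by rewrite mxE nGij.
Qed.

(** The support of a nonnegative eigenvector is closed under adjacency: if the entry at [v] is zero,
    the eigenvalue equation at [v] is a vanishing sum of nonnegative terms, so the entries at the
    neighbours of [v] are zero too. Connectedness makes the support everything. *)
Lemma perron_graph : connected_graph G ->
  exists x : 'rV[R]_n, (forall i, 0 < x 0 i) /\
    x *m weighted_adj f G = spectral_radius (weighted_adj f G) *: x.
Proof.
move=> cG; have [n_gt0 _] := cG.
have [x [x_ge0 /rV0Pn[i0 xi0] Ex]] := perron weighted_adj_sym n_gt0 weighted_adj_ge0.
exists x; split=> // i; rewrite lt0r x_ge0 andbT.
apply: (@connected_closed n G (fun i => x 0 i != 0) i0 i cG _ xi0) => u v Guv.
apply: contraNneq => xv.
have /rowP/(_ v) := Ex; rewrite mxE [RHS]mxE xv mulr0 => /psumr_eq0P E.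
have /eqP := E (fun j _ => mulr_ge0 (x_ge0 j) (weighted_adj_ge0 j v)) u isT.
by rewrite mulf_eq0 (gt_eqF (weighted_adj_gt0 Guv)) orbF.
Qed.

End WeightedGraphs.

(** * The star *)

Section Trees.
Variables (n : nat) (G : sgraph n).
Hypothesis treeG : is_tree G.

Lemma no_triangle i j k : G i j -> G j k -> G k i -> False.
Proof.
move=> ij jk ki; have [_ acG] := treeG; apply: (acG [:: i; j; k]) => //.
rewrite /ucycle /= ij jk ki /= !inE negb_or andbT.
have neq a b : G a b -> a != b by apply: contraTneq => ->; rewrite adj_irr.
by rewrite (neq i j) // (neq j k) // andbT eq_sym neq.
Qed.

Lemma no_square i j k l : i != k -> j != l -> G i j -> G j k -> G k l -> G l i -> False.
Proof.
move=> ik jl ij jk kl li; have [_ acG] := treeG; apply: (acG [:: i; j; k; l]) => //.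
rewrite /ucycle /= ij jk kl li /= !inE !negb_or andbT.
have neq a b : G a b -> a != b by apply: contraTneq => ->; rewrite adj_irr.
by rewrite (neq i j) // ik (neq j k) // jl (neq k l) // !andbT eq_sym neq.
Qed.

(* The sets [{j} :|: N(j) :\ i], for [j] adjacent to [i], are disjoint and
   avoid [i]. *)
Lemma sum_degree_le i : (\sum_(j | G i j) degree G j <= n.-1)%N.
Proof.
pose B j := j |: ([set k | G j k] :\ i).
have -> : (\sum_(j | G i j) degree G j = \sum_(j | G i j) \sum_v (v \in B j))%N.
  apply: eq_bigr => j Gij; rewrite -big_mkcond sum1_card.
  rewrite cardsU1 /degree (cardsD1 i) !inE adj_irr andbF.
  by rewrite adj_sym Gij.
rewrite exchange_big /=.
have -> : n.-1 = (\sum_(v : 'I_n) (v != i))%N.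
  by rewrite -big_mkcond sum1_card cardC1 card_ord.
apply: leq_sum => v _.
have [[j0 /andP[Gj0 Bj0]]|none] := pselect (exists j, G i j && (v \in B j)); last first.
  rewrite big1 // => j Gij; case: (boolP (v \in B j)) => // vB.
  by case: none; exists j; rewrite Gij.
have vi : v != i.
  move: Bj0; rewrite !inE => /orP[/eqP->|/andP[]//].
  by apply: contraTneq Gj0 => ->; rewrite adj_irr.
rewrite (bigD1 j0) //= Bj0 vi big1 // => j /andP[Gij jj0].
case: (boolP (v \in B j)) => // Bj; exfalso.
(* A common element of two of the sets closes a triangle or a square through [i]. *)
move: Bj Bj0; rewrite !inE vi /= => /orP[/eqP vj|Gjv] /orP[/eqP vj0|Gj0v].
- by rewrite -vj -vj0 eqxx in jj0.
- by apply: (@no_triangle i j0 v) => //; rewrite vj adj_sym.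
- by apply: (@no_triangle i j v) => //; rewrite vj0 adj_sym.
- by apply: (@no_square i j v j0) => //; rewrite 1?eq_sym // adj_sym.
Qed.

(** In [sum_degree_le] the neighbour [j] contributes its degree and each of the other
    [degree G i - 1] neighbours at least 1. *)
Lemma degree_add_le i j : G i j -> (degree G i + degree G j <= n)%N.
Proof.
move=> Gij; have := sum_degree_le i; rewrite (bigD1 j) //= => le.
have : (\sum_(k | G i k && (k != j)) 1 <= \sum_(k | G i k && (k != j)) degree G k)%N.
  by apply: leq_sum => k /andP[Gik _]; apply: (degree_gt0 (v := i)); rewrite adj_sym.
have -> : degree G i = (\sum_(k | G i k && (k != j)) 1).+1%N.
  rewrite sum1_card /degree (cardsD1 j) inE Gij add1n; congr _.+1.
  by apply: eq_card => k; rewrite !inE andbC.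
move=> h; have := leq_trans (leq_add (leqnn _) h) le.
by have := ltn_ord i; lia.
Qed.

(** The end [z] of a maximal path is a leaf. Another neighbour [k] would lie on the path by
    maximality, so the edge from [z] to [k] and the reversed path would fork at [z] and meet
    again. *)
Lemma exists_leaf : (1 < n)%N -> exists i j, G i j /\ forall k, G i k -> k = j.
Proof.
move=> n1; have [cG acG] := treeG; have [n0 _] := cG.
pose c := Ordinal n0.
have [s [/= ps us mx]] := @maximal_path _ G c [::] isT isT.
case/lastP: s ps us mx => [|s z] ps us mx.
  (* If the path is reduced to [c], then [c] is isolated, so the set of [c] alone is closed under
     adjacency and cannot miss a second vertex. *)
  suff : pred1 c (Ordinal n1) by [].
  apply: (@connected_closed n G (pred1 c) c _ cG _ (eqxx c)) => x y Gxy /eqP xc.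
  by have := mx y; rewrite /= -xc => /(_ Gxy); rewrite inE.
exists z, (last c s); split.
  by move: ps; rewrite rcons_path adj_sym => /andP[].
move=> k Gzk; apply/eqP; apply: contraT => kp.
have := @acyclic_fork n G z (rev (c :: s)) [:: k] acG.
have := rev_path G c (rcons s z); rewrite last_rcons belast_rcons => ->.
rewrite (eq_path (e' := G)) ?ps; last by move=> x y; rewrite adj_sym.
rewrite /= Gzk rev_uniq mem_rev inE.
have zk : z != k by apply: contraTneq Gzk => ->; rewrite adj_irr.
move: us; rewrite /= mem_rcons inE negb_or rcons_uniq => /andP[/andP[cz cs] /andP[zs us]].
rewrite mem_seq1 zk negb_or eq_sym cz zs cs us rev_cons.
have -> : head z (rcons (rev s) c) = last c s.
  by case/lastP: (s) => // s' y; rewrite rev_rcons last_rcons.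
rewrite eq_sym => /(_ isT isT isT isT kp).
have := mx k; rewrite last_rcons => /(_ Gzk).
rewrite inE mem_rcons inE (eq_sym k z) (negbTE zk) /= => h.
by rewrite mem_rcons inE mem_rev h.
Qed.

End Trees.

Lemma star_tree n : (0 < n)%N -> is_tree (star_graph n).
Proof.
move=> n_gt0; pose o := Ordinal n_gt0.
have oE (i : 'I_n) : (i == 0 :> nat) = (i == o) by [].
have adjE (i j : 'I_n) : star_rel i j = (i != j) && ((i == o) || (j == o)) by [].
split.
  split=> // i j.
  have co k : connect (star_graph n) o k.
    have [->|ko] := eqVneq k o; first exact: connect0.
    by apply: connect1; rewrite /= adjE eqxx eq_sym ko.
  apply: connect_trans (co j).
  by rewrite (sym_connect_sym (@adj_sym _ (star_graph n))).
(* Every edge contains the centre [o]. If [y] is not [o], both [x] and [z] are; if [y] is [o], the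
   successor of [z] must be [o] again. Either way a vertex repeats. *)
case=> [|x [|y [|z s]]] // _ /andP[]; rewrite [cycle _ _]/= => /and3P[].
rewrite !adjE => /andP[xy xyo] /andP[yz yzo] ps us.
have xz : x != z by move: us; rewrite /= !inE !negb_or => /andP[/and3P[]].
have [yo|yo] := eqVneq y o; last first.
  move: xyo yzo; rewrite (negbTE yo) orbF => /eqP xo /= /eqP zo.
  by rewrite xo zo eqxx in xz.
have zo : z != o by rewrite -yo eq_sym.
have xo : x != o by rewrite -yo.
case: s ps us => [|t s]; first by rewrite /= adjE (negbTE zo) (negbTE xo) /= !andbF.
rewrite /= adjE (negbTE zo) /= => /andP[/andP[_ /eqP->] _].
by rewrite !inE yo eqxx /= !orbT /= !andbF.
Qed.

(** * The star maximizes the spectral radius *)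

Section StarMax.
Variables (R : realType) (f : R -> R -> R).
Hypothesis wf : restricted_weight f.

Lemma weighted_adj_le_star n (G : sgraph n) i j : is_tree G ->
  weighted_adj f G i j <= (G i j)%:R * f 1 n.-1%:R.
Proof.
move=> treeG; rewrite mxE; case: ifP => Gij; last by rewrite mul0r.
rewrite mul1r; apply: weight_star_ge => //.
- exact: degree_gt0 Gij.
- by apply: (degree_gt0 (v := i)); rewrite adj_sym.
- by have := ltn_ord i; have := degree_add_le treeG Gij; lia.
Qed.

Lemma row_sum_adj n (G : sgraph n) i : \sum_j (G i j)%:R = (degree G i)%:R :> R.
Proof.
rewrite -natr_sum; congr _%:R; rewrite /degree -sum1_card [RHS]big_mkcond /=.
by apply: eq_bigr => j _; rewrite inE; case: (G i j).
Qed.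

(** The left-hand side is a row sum of the squared matrix. Each of its factors is at most
    [f 1 n.-1], and the walks from [i] through [j] number [degree G j]. *)
Lemma tree_row_sum n (G : sgraph n) i : is_tree G ->
  \sum_j \sum_k weighted_adj f G i j * weighted_adj f G j k <=
  f 1 n.-1%:R ^+ 2 * (\sum_(j | G i j) degree G j)%:R.
Proof.
move=> treeG.
have le_ij := weighted_adj_le_star _ _ treeG.
rewrite natr_sum mulr_sumr [leRHS]big_mkcond /=; apply: ler_sum => j _.
case: ifP => [Gij|/negbT nGij]; last first.
  by apply: sumr_le0 => k _; rewrite mxE (negbTE nGij) mul0r.
rewrite -row_sum_adj mulr_sumr; apply: ler_sum => k _.
rewrite expr2 -mulrA; apply: ler_pM; rewrite ?weighted_adj_ge0 //.
  by apply: le_trans (le_ij _ _) _; rewrite Gij mul1r.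
by rewrite mulrC.
Qed.

(** Summing the entries of the eigenvalue equation of the squared matrix writes [r ^+ 2] as an
    average of its row sums, with weights the entries of [x]. *)
Lemma perron_sum n (G : sgraph n) (x : 'rV[R]_n) r :
  x *m weighted_adj f G = r *: x ->
  r ^+ 2 * \sum_i x 0 i =
  \sum_i x 0 i * \sum_j \sum_k weighted_adj f G i j * weighted_adj f G j k.
Proof.
move=> Ex; set A := weighted_adj f G.
have E2 k : r ^+ 2 * x 0 k = \sum_i \sum_j x 0 i * (A i j * A j k).
  have : x *m A *m A = r ^+ 2 *: x by rewrite Ex -scalemxAl Ex scalerA.
  move/rowP/(_ k); rewrite [RHS]mxE => <-; rewrite mxE exchange_big /=.
  apply: eq_bigr => j _; rewrite mxE mulr_suml.
  by apply: eq_bigr => i _; rewrite mulrA.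
rewrite mulr_sumr (eq_bigr _ (fun k _ => E2 k)) exchange_big /=.
apply: eq_bigr => i _; rewrite exchange_big mulr_sumr; apply: eq_bigr => j _.
by rewrite mulr_sumr.
Qed.

(** An average with positive weights is at most the common bound of the row sums, and strictly less
    if a single row sum is. *)
Lemma tree_spectral_radius_le n (G : sgraph n) : is_tree G ->
  spectral_radius (weighted_adj f G) ^+ 2 <= f 1 n.-1%:R ^+ 2 * n.-1%:R /\
  (spectral_radius (weighted_adj f G) ^+ 2 = f 1 n.-1%:R ^+ 2 * n.-1%:R ->
   (1 < n)%N -> forall i, (\sum_(j | G i j) degree G j = n.-1)%N).
Proof.
move=> treeG; have [cG _] := treeG.
have [x [x_gt0 Ex]] := perron_graph wf cG.
set r := spectral_radius _ in Ex *; set w := f 1 _.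
have row i : \sum_j \sum_k weighted_adj f G i j * weighted_adj f G j k <=
    w ^+ 2 * n.-1%:R.
  apply: le_trans (tree_row_sum _ treeG) _.
  by rewrite ler_wpM2l ?sqr_ge0 // ler_nat sum_degree_le.
have S_gt0 : 0 < \sum_i x 0 i.
  have [n_gt0 _] := cG; rewrite (bigD1 (Ordinal n_gt0)) //= ltr_pwDl //.
  by apply: sumr_ge0 => i _; exact: ltW.
split.
  rewrite -(ler_pM2r S_gt0) (perron_sum Ex) mulr_sumr.
  by apply: ler_sum => i _; rewrite mulrC ler_wpM2r // ltW.
move=> Er n1 i; apply/eqP; rewrite eqn_leq sum_degree_le //= leqNgt; apply/negP => lti.
have w_gt0 : 0 < w by apply: weight_gt0; rewrite // ler1n; lia.
have : r ^+ 2 * \sum_i x 0 i < w ^+ 2 * n.-1%:R * \sum_i x 0 i.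
  rewrite (perron_sum Ex) mulr_sumr (bigD1 i) //= [ltRHS](bigD1 i) //=.
  apply: ltr_leD; last by apply: ler_sum => j _; rewrite mulrC ler_wpM2r // ltW.
  rewrite mulrC ltr_pM2r //; apply: le_lt_trans (tree_row_sum _ treeG) _.
  by rewrite ltr_pM2l ?exprn_gt0 // ltr_nat.
by rewrite Er ltxx.
Qed.

Lemma star_spectral_radius_ge n : (1 < n)%N ->
  f 1 n.-1%:R * Num.sqrt n.-1%:R <= spectral_radius (weighted_adj f (star_graph n)).
Proof.
move=> n1; pose o := Ordinal (ltnW n1).
set w := f 1 _; set q := Num.sqrt _.
have q_gt0 : 0 < q by rewrite sqrtr_gt0 ltr0n; lia.
have q2 : q * q = n.-1%:R by rewrite -expr2 sqr_sqrtr.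
have adjE i j : star_graph n i j = (i != j) && ((i == o) || (j == o)) by [].
have degO : (n.-1 <= degree (star_graph n) o)%N.
  have <- : #|[set~ o]| = n.-1 by rewrite cardsC1 card_ord.
  apply/subset_leq_card/fintype.subsetP => j; rewrite !inE => jo.
  by rewrite adjE eqxx eq_sym jo.
have geO i : i != o -> w <= weighted_adj f (star_graph n) o i.
  move=> io; rewrite -[weighted_adj _ _]weighted_adj_sym // mxE.
  have Gio : star_graph n i o by rewrite adjE io eqxx orbT.
  by apply: (weighted_adj_ge wf Gio (l1 := 1)); rewrite ?(degree_gt0 Gio) ?degO //; lia.
(* The Perron vector of the unweighted star, whose eigenvalue is [q]. *)
pose x : 'rV[R]_n := \row_i (if i == o then q else 1).
have x_ge0 i : 0 <= x 0 i by rewrite mxE; case: ifP => // _; exact: ltW.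
have xA_ge0 i j : 0 <= x 0 i * weighted_adj f (star_graph n) i j.
  by rewrite mulr_ge0 ?weighted_adj_ge0.
apply: (spectral_radius_ge_sub (x := x)); rewrite ?weighted_adj_sym //; first exact: ltnW.
  by apply/rV0Pn; exists o; rewrite mxE eqxx gt_eqF.
move=> j; rewrite [leRHS]mxE [leRHS](bigD1 o) //= [x 0 j]mxE [x 0 o]mxE eqxx.
have [->|jo] := eqVneq j o; last first.
  rewrite mulr1 mulrC -[leLHS]addr0 lerD ?sumr_ge0 //.
  by rewrite ler_wpM2l ?geO // ltW.
rewrite -mulrA q2 -[leLHS]add0r lerD ?mulr_ge0 ?weighted_adj_ge0 //; first exact: ltW.
have -> : w * n.-1%:R = \sum_(i < n | i != o) w.
  rewrite sumr_const mulr_natr; congr (_ *+ _).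
  by rewrite -[n in LHS]card_ord -(cardsC1 o); apply: eq_card => i; rewrite !inE.
apply: ler_sum => i io.
rewrite mxE (negbTE io) mul1r -[weighted_adj _ _]weighted_adj_sym // mxE.
exact: geO.
Qed.

(** At a leaf [i] the sum is the degree of its one neighbour [j], which is therefore adjacent to
    every other vertex. A further edge would close a triangle with [j], so swapping [j] and [0] is
    an isomorphism. *)
Lemma star_max_unique n (G : sgraph n) : is_tree G -> (1 < n)%N ->
  (forall i, (\sum_(j | G i j) degree G j = n.-1)%N) -> isomorphic G (star_graph n).
Proof.
move=> treeG n1 Gsum.
have [i [j [Gij leaf]]] := exists_leaf treeG n1.
have Ej : degree G j = n.-1.
  rewrite -(Gsum i) (bigD1 j) //= big1 ?addn0 // => k /andP[/leaf->].
  by rewrite eqxx.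
have Gj k : k != j -> G j k.
  have /subset_leqif_cards [_] : [set k | G j k] \subset [set~ j].
    by apply/fintype.subsetP => l; rewrite !inE; apply: contraTneq => ->; rewrite adj_irr.
  rewrite -/(degree G j) Ej cardsC1 card_ord eqxx => /esym/eqP/setP/(_ k).
  by rewrite !inE => ->.
pose o := Ordinal (ltnW n1).
exists (tperm j o) => u v.
have -> : star_graph n (tperm j o u) (tperm j o v) =
    (tperm j o u != tperm j o v) && ((tperm j o u == o) || (tperm j o v == o)) by [].
rewrite (inj_eq perm_inj).
have tE a : (tperm j o a == o) = (a == j).
  by rewrite -(inj_eq (@perm_inj _ (tperm j o)) a j) tpermL.
rewrite !tE; have [<-|uv] := eqVneq u v; first by rewrite adj_irr.
have [uj|uj] := eqVneq u j; first by rewrite uj Gj // -uj eq_sym.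
have [vj|vj] := eqVneq v j; first by rewrite vj adj_sym Gj.
apply/esym/negP => Guv; apply: (@no_triangle _ _ treeG u v j) => //.
  by rewrite adj_sym Gj.
exact: Gj.
Qed.

(** The number [b] separates the two spectral radii; if they agree, both equal [b] and the equality
    case of the upper bound applies. *)
Lemma star_spectral_radius n (G : sgraph n) : is_tree G -> (1 < n)%N ->
  spectral_radius (weighted_adj f G) <= spectral_radius (weighted_adj f (star_graph n))
  /\ (spectral_radius (weighted_adj f G) =
      spectral_radius (weighted_adj f (star_graph n)) -> isomorphic G (star_graph n)).
Proof.
move=> treeG n1; have ge_star := star_spectral_radius_ge n1.
have [leG eqG] := tree_spectral_radius_le treeG.
set b := f 1 _ * _ in ge_star.
have w_gt0 : 0 < f 1 n.-1%:R by apply: weight_gt0; rewrite // ler1n; lia.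
have b_ge0 : 0 <= b by rewrite mulr_ge0 ?sqrtr_ge0 ?ltW.
have Eb : b ^+ 2 = f 1 n.-1%:R ^+ 2 * n.-1%:R by rewrite exprMn sqr_sqrtr.
have leb : spectral_radius (weighted_adj f G) <= b.
  rewrite -Eb in leG; apply: le_trans (ler_norm _) _.
  by rewrite -(ger0_norm b_ge0) -ler_sqr ?nnegrE // !real_normK ?num_real.
split; first exact: le_trans ge_star.
move=> EG; apply: (star_max_unique treeG n1); apply: (eqG _ n1).
by rewrite -Eb; congr (_ ^+ 2); apply: le_anti; rewrite leb EG.
Qed.

End StarMax.

(** * The Perron vector of the path *)

Lemma path_tree n : (0 < n)%N -> is_tree (path_graph n).
Proof.
move=> n_gt0; split.
  split=> //; pose o := Ordinal n_gt0.
  have co k : connect (path_graph n) o k.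
    case: k => k; elim: k => [|k IH] kn.
      by rewrite (_ : Ordinal kn = o) ?connect0 //; exact: val_inj.
    apply: connect_trans (IH (ltnW kn)) (connect1 _).
    by rewrite /= /path_rel /= eqxx.
  move=> i j; apply: connect_trans (co j).
  by rewrite (sym_connect_sym (@adj_sym _ (path_graph n))).
move=> p sp.
case: p sp => // i0 p0; set p := i0 :: p0 => sp.
(* Rotate the cycle to start at its largest vertex [v]. The two vertices next to [v] on the cycle
   are both its predecessor in the path, hence equal, against simplicity. *)
have [v vp maxv] := @arg_maxnP _ i0 (mem p) (@nat_of_ord n) (mem_head _ _).
have [k s Es] := rot_to vp.
rewrite -(rot_ucycle k) Es.
have memv w : w \in v :: s -> (w <= v)%N by rewrite -Es mem_rot => /maxv.
have : (2 < size (v :: s))%N by rewrite -Es size_rot.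
case: s {Es} memv => // y s; case/lastP: s => // s z memv _.
rewrite /ucycle /= rcons_path last_rcons => /andP[/and3P[vy _ zv]].
have yv : (y <= v)%N by apply: memv; rewrite !inE eqxx orbT.
have zlv : (z <= v)%N by apply: memv; rewrite !inE mem_rcons inE eqxx !orbT.
have -> : y = z.
  by apply: ord_inj; move: vy zv; rewrite /= /path_rel; lia.
by rewrite mem_rcons inE eqxx !andbF.
Qed.

Lemma path_degree n (i : 'I_n) :
  degree (path_graph n) i = ((0 < i) + (i.+1 < n))%N.
Proof.
pose prev := [set j : 'I_n | j.+1 == i :> nat]; pose next := [set j : 'I_n | i.+1 == j :> nat].
have dis : prev :&: next = finset.set0 by apply/setP => j; rewrite !inE; lia.
have -> : degree (path_graph n) i = (#|prev| + #|next|)%N.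
  rewrite -cardsUI dis cards0 addn0; apply: eq_card => j.
  by rewrite !inE /= /path_rel orbC.
congr (_ + _)%N.
  have [i0|i_gt0] := posnP i.
    by apply: eq_card0 => j; rewrite !inE i0.
  have lt : (i.-1 < n)%N by have := ltn_ord i; lia.
  rewrite -[nat_of_bool true](cards1 (Ordinal lt)); apply: eq_card => j; rewrite !inE -val_eqE /=; lia.
have [lt|ge] := ltnP i.+1 n.
  rewrite -[nat_of_bool true](cards1 (Ordinal lt)); apply: eq_card => j; rewrite !inE -val_eqE /=; lia.
by apply: eq_card0 => j; rewrite !inE; have := ltn_ord j; lia.
Qed.

Section PathPerron.
Variables (R : realType) (f : R -> R -> R).
Hypothesis wf : restricted_weight f.
Local Notation a := (f 1 2).
Local Notation b := (f 2 2).

Let a_gt0 : 0 < a. Proof. by apply: weight_gt0 => //; lra. Qed.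
Let b_gt0 : 0 < b. Proof. by apply: weight_gt0 => //; lra. Qed.

Lemma path_weight_le n i j : weighted_adj f (path_graph n) i j <= b.
Proof.
rewrite mxE; case: ifP => [Gij|_]; last exact: ltW.
have Gji : path_graph n j i by rewrite adj_sym.
apply: weight_nondecreasing => //; rewrite ?ler1n ?ler_nat;
  rewrite ?(degree_gt0 Gij) ?(degree_gt0 Gji) //.
  by rewrite path_degree; lia.
by rewrite path_degree; lia.
Qed.

(** The spectral radius is an average of the row sums, weighted by the Perron vector. Each is at
    most [2 * b], and the row of the end vertex [0] has at most one nonzero entry. *)
Lemma path_spectral_radius_lt n : (0 < n)%N ->
  spectral_radius (weighted_adj f (path_graph n)) < 2 * b.
Proof.
move=> n_gt0.
have [x [x_gt0 Ex]] := perron_graph wf (path_tree n_gt0).1.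
set A := weighted_adj _ _ in Ex *.
have S_gt0 : 0 < \sum_i x 0 i.
  rewrite (bigD1 (Ordinal n_gt0)) //= ltr_pwDl //.
  by apply: sumr_ge0 => i _; exact: ltW.
rewrite -(ltr_pM2r S_gt0).
have -> : spectral_radius A * \sum_i x 0 i = \sum_i x 0 i * \sum_j A i j.
  have E j : spectral_radius A * x 0 j = \sum_i x 0 i * A i j.
    by have /rowP/(_ j) := Ex; rewrite mxE [RHS]mxE => <-.
  rewrite mulr_sumr (eq_bigr _ (fun j _ => E j)) exchange_big /=.
  by apply: eq_bigr => i _; rewrite mulr_sumr.
have row i : \sum_j A i j <= (degree (path_graph n) i)%:R * b.
  rewrite /degree -sum1_card natr_sum mulr_suml [leRHS]big_mkcond /=.
  apply: ler_sum => j _; rewrite inE; case: ifP => [Gij|nG].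
    by rewrite mul1r path_weight_le.
  by rewrite mxE /= nG.
rewrite mulr_sumr (bigD1 (Ordinal n_gt0)) //= [ltRHS](bigD1 (Ordinal n_gt0)) //=.
apply: ltr_leD; last first.
  apply: ler_sum => i _; rewrite mulrC ler_pM2r //; apply: le_trans (row i) _.
  by rewrite ler_pM2r // ler_nat path_degree; lia.
rewrite mulrC ltr_pM2r //; apply: le_lt_trans (row _) _.
by rewrite ltr_pM2r // ltr_nat path_degree /=; lia.
Qed.

End PathPerron.

Section PathPerron.
Variables (R : realType) (f : R -> R -> R).
Hypothesis wf : restricted_weight f.
Local Notation a := (f 1 2).
Local Notation b := (f 2 2).

Let a_gt0 : 0 < a. Proof. by apply: weight_gt0 => //; lra. Qed.
Let b_gt0 : 0 < b. Proof. by apply: weight_gt0 => //; lra. Qed.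

Section Sym.
Variable m : nat.
Hypothesis m3 : (2 < m)%N.
Local Notation A := (weighted_adj f (path_graph m.+1)).
Local Notation lam := (spectral_radius A).
Local Notation ord k := (inord k : 'I_m.+1).

Lemma path_weightE (i j : 'I_m.+1) : A i j =
  if path_rel i j then
    if [&& 0 < i, 0 < j, i < m & j < m]%N then b else a
  else 0.
Proof.
rewrite mxE /=; case: ifP => // ij; rewrite !path_degree.
have sa : f 2 1 = a by apply: weight_sym => //; lra.
have := ltn_ord i; have := ltn_ord j; rewrite !ltnS => jm im.
have [i0|i0] := posnP i; have [j0|j0] := posnP j; have [im'|im'] := ltnP i m;
  have [jm'|jm'] := ltnP j m; rewrite //= ?sa //; exfalso; move: ij;
  rewrite /path_rel; lia.
Qed.

Lemma path_eigen_rev (x : 'rV[R]_m.+1) : x *m A = lam *: x ->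
  (\row_i x 0 (rev_ord i)) *m A = lam *: \row_i x 0 (rev_ord i).
Proof.
move=> Ex; apply/rowP => j.
have /rowP/(_ (rev_ord j)) := Ex; rewrite mxE [RHS]mxE => E.
rewrite mxE [RHS]mxE mxE -E [RHS](reindex_inj rev_ord_inj) /=.
apply: eq_bigr => i _; rewrite mxE; congr (_ * _); rewrite !path_weightE.
have := ltn_ord i; have := ltn_ord j => jm im.
have -> : path_rel (rev_ord i) (rev_ord j) = path_rel i j.
  by rewrite /path_rel /=; lia.
by case: ifP => // ij; congr (if _ then _ else _); rewrite /=; lia.
Qed.

Lemma path_eigen_row (x : 'rV[R]_m.+1) k : x *m A = lam *: x -> (0 < k < m)%N ->
  lam * x 0 (ord k) =
  x 0 (ord k.-1) * A (ord k.-1) (ord k) + x 0 (ord k.+1) * A (ord k.+1) (ord k).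
Proof.
move=> /rowP/(_ (ord k)) + km; rewrite mxE [RHS]mxE => <-.
rewrite (bigD1 (ord k.-1)) //= (bigD1 (ord k.+1)) /=; last first.
  by rewrite -val_eqE /= !inordK; lia.
rewrite big1 ?addr0 // => i /andP[]; rewrite -!val_eqE /= !inordK; try lia.
move=> ik ik'; rewrite path_weightE /path_rel inordK; last lia.
by case: ifP; rewrite ?mulr0 //; lia.
Qed.

Lemma path_eigen_row0 (x : 'rV[R]_m.+1) : x *m A = lam *: x ->
  lam * x 0 (ord 0) = x 0 (ord 1) * a.
Proof.
move=> /rowP/(_ (ord 0)) + ; rewrite mxE [RHS]mxE => <-.
rewrite (bigD1 (ord 1)) //= path_weightE /path_rel !inordK //=; try lia.
rewrite big1 ?addr0 // => i; rewrite -val_eqE /= inordK; last lia.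
move=> i1; rewrite path_weightE /path_rel inordK //=.
by case: ifP; rewrite ?mulr0 //; lia.
Qed.

Lemma path_perron : exists x : 'rV[R]_m.+1,
  [/\ forall i, 0 < x 0 i, x *m A = lam *: x,
      forall k, (k <= m)%N -> x 0 (ord (m - k)) = x 0 (ord k) &
      forall p j, (p <= j <= m - p)%N -> x 0 (ord p) <= x 0 (ord j)].
Proof.
have [x0 [x0_gt0 Ex0]] := perron_graph wf (path_tree (ltn0Sn m)).1.
(* Adding the mirror image makes the Perron vector symmetric. *)
pose x : 'rV_m.+1 := x0 + \row_i x0 0 (rev_ord i).
have x_gt0 i : 0 < x 0 i by rewrite !mxE addr_gt0.
have Ex : x *m A = lam *: x by rewrite mulmxDl scalerDr Ex0 path_eigen_rev.
have symx k : (k <= m)%N -> x 0 (ord (m - k)) = x 0 (ord k).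
  move=> km; rewrite !mxE addrC; congr (x0 0 _ + x0 0 _); apply: val_inj;
  by rewrite /= !inordK; lia.
have lamb := path_spectral_radius_lt wf (ltn0Sn m).
(* Away from the ends both edges at [k] have weight [b], and the spectral radius is below
   [2 * b]. *)
have concave k : (1 < k < m.-1)%N ->
    x 0 (ord k.-1) + x 0 (ord k.+1) <= 2 * x 0 (ord k).
  move=> km; rewrite -(ler_pM2r b_gt0).
  have := path_eigen_row Ex (_ : 0 < k < m)%N.
  rewrite !path_weightE /path_rel !inordK; try lia.
  have -> : ((k.-1.+1 == k) || (k.+1 == k.-1))%N by lia.
  have -> : ((k.+2 == k) || (k.+1 == k.+1))%N by lia.
  have -> : [&& 0 < k.-1, 0 < k, k.-1 < m & k < m]%N by lia.
  have -> : [&& 0 < k.+1, 0 < k, k.+1 < m & k < m]%N by lia.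
  move=> E; rewrite mulrDl -E; last lia.
  by rewrite mulrAC ler_pM2r // ltW.
(* Induction from the middle outwards. Near the middle the symmetry compares the entries; further
   out, concavity at [k.+1] passes the increase from [k.+1] to [k]. *)
have step k : (0 < k)%N -> (k.*2.+1 <= m)%N -> x 0 (ord k) <= x 0 (ord k.+1).
  have [d] := ubnP (m - k.*2); elim: d k => // d IH k ltd k0 km.
  have [E|neq] := eqVneq k.*2.+1 m.
    have Ek : (m - k)%N = k.+1 by lia.
    by rewrite -(symx k) ?Ek //; lia.
  have := concave k.+1; rewrite /= (_ : 1 < k.+1 < m.-1)%N; last lia.
  move=> /(_ isT) conc; have [E|neq'] := eqVneq k.*2.+2 m.
    have : x 0 (ord k.+2) = x 0 (ord k).
      have Ek : (m - k)%N = k.+2 by lia.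
      by rewrite -(symx k) ?Ek //; lia.
    by lra.
  have := IH k.+1; have : (m - k.+1.*2 < d)%N by lia.
  by move=> -> /(_ isT isT); rewrite (_ : (k.+1.*2.+1 <= m)%N); [lra|lia].
(* The end edge has weight [a], so concavity is replaced by the first two eigenvalue equations. If
   [x] decreased from 0 to 1, the first would force [lam < a] and the second would fail. *)
have step0 : x 0 (ord 0) <= x 0 (ord 1).
  have := path_eigen_row Ex (_ : 0 < 1 < m)%N.
  rewrite !path_weightE /path_rel !inordK; try lia.
  rewrite /= m3 (ltnW m3) /= => /(_ isT) E1.
 have := path_eigen_row0 Ex => E0.
  have x2 : 0 < x 0 (ord 2) * b by rewrite mulr_gt0.
  rewrite leNgt; apply/negP => lt.
  have : a * x 0 (ord 1) < a * x 0 (ord 0) by rewrite ltr_pM2l.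
  have := x_gt0 (ord 1); have := x_gt0 (ord 0).
  have [la|la] := lerP a lam.
    by have := ler_wpM2r (ltW (x_gt0 (ord 0))) la; lra.
  have : lam * x 0 (ord 1) < a * x 0 (ord 1) by rewrite ltr_pM2r.
  by lra.
exists x; split=> //.
have mono p j : (p <= j)%N -> (j.*2 <= m)%N -> x 0 (ord p) <= x 0 (ord j).
  elim: j => [|j IH]; first by rewrite leqn0 => /eqP->.
  rewrite leq_eqVlt => /orP[/eqP->//|pj jm].
  apply: le_trans (IH _ _) _; try lia.
  by have [->//|j0] := posnP j; apply: step; lia.
move=> p j pj; have [jm|jm] := leqP j.*2 m; first by apply: mono; lia.
by rewrite -(symx j); [apply: mono|]; lia.
Qed.

End Sym.
End PathPerron.

(** * Spiders *)

Lemma ltr_sum_at (R : realDomainType) (I : finType) (F G : I -> R) (i0 : I) :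
  (forall i, F i <= G i) -> F i0 < G i0 -> \sum_i F i < \sum_i G i.
Proof.
move=> leFG ltFG; rewrite (bigD1 i0) //= [ltRHS](bigD1 i0) //=.
by apply: ltr_leD => //; apply: ler_sum.
Qed.

Section Spider.
Variables (R : realType) (f : R -> R -> R).
Hypothesis wf : restricted_weight f.
Local Notation a := (f 1 2).
Local Notation b := (f 2 2).

(** Write [v_k] for [s (ord k)]. The first leg is [v_0 ... v_(p-1)], attached to the centre [v_c] at
    [v_(p-1)]; the second is [v_p ... v_(c-1)], with tip [v_p]; the third is [v_(c+1) ... v_m]. *)
Variables (m p q r : nat) (T : sgraph m.+1) (s : 'S_m.+1).
Hypotheses (p_gt0 : (0 < p)%N) (q_gt0 : (0 < q)%N) (le_pr : (p <= r)%N).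
Hypothesis Em : m = (p + q + r)%N.
Local Notation c := (p + q)%N.
Local Notation ord k := (inord k : 'I_m.+1).
Hypothesis Tedge : forall k, (k < m)%N -> k.+1 != p -> T (s (ord k)) (s (ord k.+1)).
Hypothesis Tbranch : T (s (ord p.-1)) (s (ord c)).
Local Notation AP := (weighted_adj f (path_graph m.+1)).
Local Notation AT := (weighted_adj f T).
Local Notation d k := (degree T (s (ord k))).

Let a_gt0 : 0 < a. Proof. by apply: weight_gt0 => //; lra. Qed.
Let b_gt0 : 0 < b. Proof. by apply: weight_gt0 => //; lra. Qed.
Let le_ab : a <= b. Proof. exact: weight12_le22. Qed.
Let le_b13 : b <= f 1 3. Proof. exact: weight22_le13. Qed.
Let f31 : f 3 1 = f 1 3. Proof. by apply: weight_sym => //; lra. Qed.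
Let f21 : f 2 1 = a. Proof. by apply: weight_sym => //; lra. Qed.

Let s_neq k l : (k <= m)%N -> (l <= m)%N -> k != l -> s (ord k) != s (ord l).
Proof. by move=> km lm; rewrite (inj_eq perm_inj) -val_eqE /= !inordK. Qed.

Let Tedge' k : (0 < k <= m)%N -> k != p -> T (s (ord k)) (s (ord k.-1)).
Proof. by case: k => // k km kp; rewrite adj_sym Tedge. Qed.

Let spider_deg2 k : (0 < k < m)%N -> k != p -> (2 <= d k)%N.
Proof.
move=> km kp; have Tk := Tedge' (_ : 0 < k <= m)%N kp.
have [kp1|kp1] := eqVneq k.+1 p.
  apply: (@size_le_degree _ _ _ [:: s (ord k.-1); s (ord c)]).
    by rewrite /= inE andbT; apply: s_neq; lia.
  by rewrite /= Tk; [rewrite (_ : k = p.-1) ?Tbranch //; lia|lia].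
apply: (@size_le_degree _ _ _ [:: s (ord k.-1); s (ord k.+1)]).
  by rewrite /= inE andbT; apply: s_neq; lia.
by rewrite /= Tk ?Tedge //; lia.
Qed.

Let spider_deg3 : (3 <= d c)%N.
Proof.
apply: (@size_le_degree _ _ _ [:: s (ord c.-1); s (ord c.+1); s (ord p.-1)]).
  by rewrite /= !inE negb_or andbT !s_neq //; lia.
by rewrite /= Tedge' ?Tedge 1?adj_sym ?Tbranch //; lia.
Qed.

Let ATge (l1 l2 : nat) k l : T (s (ord k)) (s (ord l)) -> (0 < l1 <= d k)%N ->
  (0 < l2 <= d l)%N -> f l1%:R l2%:R <= AT (s (ord k)) (s (ord l)).
Proof. exact: weighted_adj_ge. Qed.

(** On the common edges only the one leaving the tip [v_p] may lose weight, at most [b - a]; the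
    edge entering the centre from the second leg gains at least as much. *)
Let spider_edge k : (k < m)%N -> k.+1 != p ->
  AP (ord k) (ord k.+1) + (b - a) * (k.+1 == c)%:R - (b - a) * (k == p)%:R <=
  AT (s (ord k)) (s (ord k.+1)).
Proof.
move=> km kp; have Tk := Tedge km kp.
have dk : (1 <= d k)%N := degree_gt0 Tk.
have dk1 : (1 <= d k.+1)%N by apply: (@degree_gt0 _ _ _ (s (ord k))); rewrite adj_sym.
have le_AP := path_weight_le wf (ord k) (ord k.+1).
have leab := le_ab; have leb13 := le_b13.
have [kc|kc] := eqVneq k.+1 c.
  have d3 : (3 <= d k.+1)%N by rewrite kc spider_deg3.
  (* For [q = 1] the gaining and the losing edge coincide, the corrections cancel and [f 1 3 >= b]
     suffices. *)
  have [kp'|kp'] := eqVneq k p.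
    have : f 1 3 <= _ := ATge (l1 := 1) (l2 := 3) Tk dk d3.
    by lra.
  have d2 : (2 <= d k)%N by apply: spider_deg2 => //; lia.
  have : f 2 3 <= _ := ATge (l1 := 2) (l2 := 3) Tk d2 d3.
  by rewrite mulr1 mulr0; have := weight23_ge wf; lra.
have [kp'|kp'] := eqVneq k p.
  have d2 : (2 <= d k.+1)%N by apply: spider_deg2 => //; lia.
  have : a <= _ := ATge (l1 := 1) (l2 := 2) Tk dk d2.
  by rewrite mulr0 mulr1; lra.
rewrite !mulr0 subr0 addr0.
have [Ekc|kc'] := eqVneq k c.
  have d3 : (3 <= d k)%N by rewrite Ekc spider_deg3.
  have : f 3 1 <= _ := ATge (l1 := 3) (l2 := 1) Tk d3 dk1.
  by rewrite f31; lra.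
have m3 : (2 < m)%N by lia.
rewrite (path_weightE wf m3) /path_rel !inordK; try lia.
rewrite eqxx /=.
have [k0|k0] := posnP k.
  have d2 : (2 <= d k.+1)%N by apply: spider_deg2 => //; lia.
  exact: (ATge (l1 := 1) (l2 := 2) Tk dk d2).
have d2 : (2 <= d k)%N by apply: spider_deg2 => //; lia.
have [k1m|k1m] := ltnP k.+1 m; last first.
  have : f 2 1 <= _ := ATge (l1 := 2) (l2 := 1) Tk d2 dk1.
  by rewrite f21 /= andbF.
have d2' : (2 <= d k.+1)%N by apply: spider_deg2 => //; lia.
have : b <= _ := ATge (l1 := 2) (l2 := 2) Tk d2 d2'.
by rewrite km.
Qed.

Let e : R := AP (ord p.-1) (ord p).

Let e_gt0 : 0 < e.
Proof.
by apply: weighted_adj_gt0 => //; rewrite /= /path_rel !inordK; lia.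
Qed.

Let e_le_branch : e <= AT (s (ord p.-1)) (s (ord c)).
Proof.
have : f 1 3 <= _ := ATge (l1 := 1) (l2 := 3) Tbranch (degree_gt0 Tbranch) spider_deg3.
have := path_weight_le wf (ord p.-1) (ord p).
by have := le_b13; rewrite -/e; lra.
Qed.

Let edge_mx (k l : nat) : 'M[R]_m.+1 :=
  delta_mx (ord k) (ord l) + delta_mx (ord l) (ord k).

(** The passage from path to spider: weight [e] moves from the removed edge to the new one, and
    [b - a] from the edge after [v_p] to the edge before the centre. The sum [AP + D] bounds the
    spider's matrix from below entrywise. *)
Let D : 'M[R]_m.+1 := e *: (edge_mx p.-1 c - edge_mx p.-1 p) +
  (b - a) *: (edge_mx c.-1 c - edge_mx p p.+1).

Let edge_mxE k l (i j : 'I_m.+1) : (k < l <= m)%N -> (i < j)%N ->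
  edge_mx k l i j = ((i == k :> nat) && (j == l :> nat))%:R.
Proof.
move=> kl ij; rewrite !mxE -!val_eqE /= !inordK; try lia.
by rewrite [X in _ + X](_ : _ = 0) ?addr0 // (_ : _ && _ = false) //; lia.
Qed.

Let edge_mx_tr k l : (edge_mx k l)^T = edge_mx k l.
Proof. by rewrite /edge_mx linearD /= !trmx_delta addrC. Qed.

Let entry_lt (i j : 'I_m.+1) : (i < j)%N -> AP i j + D i j <= AT (s i) (s j).
Proof.
move=> ij; have jm := ltn_ord j.
have -> : D i j = e * (edge_mx p.-1 c i j - edge_mx p.-1 p i j) +
  (b - a) * (edge_mx c.-1 c i j - edge_mx p p.+1 i j) by rewrite !mxE.
rewrite !edge_mxE //; try lia.
have APE : (i.+1 != j)%N -> AP i j = 0.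
  by move=> nij; rewrite mxE /= /path_rel; case: ifP => //; lia.
rewrite -(inord_val i) -(inord_val j) in APE *.
move: (nat_of_ord i) (nat_of_ord j) ij jm APE => {}i {}j ij jm APE.
rewrite !inordK in APE *; try lia.
have [Ei|ip] := eqVneq i p.-1.
  have [Ej|jc] := eqVneq j c.
    rewrite APE; last lia.
    have -> : (j == p) = false by lia.
    have -> : (i == c.-1) = false by lia.
    have -> : (i == p) = false by lia.
    by rewrite Ei Ej /= mulr1n mulr0n; have := e_le_branch; lra.
  have -> : (i == p) = false by lia.
  rewrite andbF /=.
  have [Ej|jp] := eqVneq j p.
    rewrite Ei Ej -/e; have := weighted_adj_ge0 T wf (s (ord p.-1)) (s (ord p)).
    by rewrite ?andbF mulr1n mulr0n; lra.
  rewrite APE; last lia.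
  by have := weighted_adj_ge0 T wf (s (ord i)) (s (ord j)); rewrite ?andbF mulr0n; lra.
have [Ej|nij] := eqVneq i.+1 j; last first.
  rewrite APE //.
  have -> : (i == c.-1) && (j == c) = false by lia.
  have -> : (i == p) && (j == p.+1) = false by lia.
  by have := weighted_adj_ge0 T wf (s (ord i)) (s (ord j)); rewrite ?andbF mulr0n; lra.
rewrite -Ej.
have -> : (i == c.-1) && (i.+1 == c) = (i.+1 == c) by lia.
have -> : (i == p) && (i.+1 == p.+1) = (i == p) by lia.
have im : (i < m)%N by lia.
have ip1 : i.+1 != p by lia.
by have := spider_edge im ip1; lra.
Qed.

Let entry (i j : 'I_m.+1) : AP i j + D i j <= AT (s i) (s j).
Proof.
have symD : D^T = D by rewrite /D linearD !linearZ /= !linearB /= !edge_mx_tr.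
have [ij|ji|Eij] := ltngtP i j; first exact: entry_lt.
  rewrite -(weighted_adj_sym T wf) -(weighted_adj_sym (path_graph _) wf) -symD.
  by rewrite [in leLHS]mxE [X in _ + X]mxE [leRHS]mxE; exact: entry_lt.
move/val_inj: Eij => <-.
have E0 k l : (k < l <= m)%N -> edge_mx k l i i = 0.
  move=> kl; rewrite !mxE -!val_eqE /= !inordK; try lia.
  have -> : (i == k :> nat) && (i == l :> nat) = false by lia.
  have -> : (i == l :> nat) && (i == k :> nat) = false by lia.
  exact: addr0.
have -> : D i i = e * (edge_mx p.-1 c i i - edge_mx p.-1 p i i) +
  (b - a) * (edge_mx c.-1 c i i - edge_mx p p.+1 i i) by rewrite !mxE.
rewrite !E0; try lia.
by rewrite subrr !mulr0 !addr0 !mxE !adj_irr.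
Qed.

Let quad_edge (x : 'rV[R]_m.+1) k l :
  (x *m edge_mx k l *m x^T) 0 0 = 2 * (x 0 (ord k) * x 0 (ord l)).
Proof.
have E u v : (x *m delta_mx u v *m x^T) 0 0 = x 0 u * x 0 v.
  have -> : delta_mx u v = delta_mx u (0 : 'I_1) *m delta_mx 0 v :> 'M[R]_m.+1.
    by rewrite mul_delta_mx.
  rewrite !mulmxA -mulmxA mxE big_ord1; congr (_ * _).
    by rewrite -colE mxE.
  by rewrite -rowE !mxE.
by rewrite /edge_mx mulmxDr mulmxDl mxE !E; ring.
Qed.

Lemma spider_gt : spectral_radius AP < spectral_radius AT.
Proof.
have m3 : (2 < m)%N by lia.
have cm : (c < m)%N by lia.
have [cp cp'] : c.+1 != p /\ c != p by lia.
have [lecm lec1m pm] : [/\ (c <= m)%N, (c.-1 <= m)%N & (p.-1 < m.+1)%N] by split; lia.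
have pc0 : (p <= c <= m - p)%N by lia.
have pc : (p <= c.-1 <= m - p)%N by lia.
have lt_pr : p != r -> (p.+1 <= c <= m - p.+1)%N by lia.
have eq_pr : p = r -> (m - c)%N = p /\ (m - c.-1)%N = p.+1 by lia.
have nbranch : ~~ ((p.-1.+1 == c) || (c.+1 == p.-1))%N by lia.
have cS : (c < m.+1)%N := lecm.
have AP0 : AP (ord p.-1) (ord c) = 0.
  have np : path_rel (ord p.-1) (ord c) = false.
    by rewrite /path_rel (inordK pm) (inordK cS) (negbTE nbranch).
  by rewrite mxE [path_graph _ _ _]/= np.
have [x [x_gt0 Ex symx monox]] := path_perron wf m3.
set lam := spectral_radius AP in Ex *.
pose y : 'rV[R]_m.+1 := \row_v x 0 ((s^-1)%g v).
have yE i : y 0 (s i) = x 0 i by rewrite mxE permK.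
have y0 : y != 0.
  by apply/rV0Pn; exists (s (ord 0)); rewrite yE gt_eqF.
have yAE i : (y *m AT) 0 (s i) = \sum_j x 0 j * AT (s j) (s i).
  rewrite mxE (reindex_inj (@perm_inj _ s)) /=.
  by apply: eq_bigr => j _; rewrite yE.
have quadP : (x *m AP *m x^T) 0 0 = lam * (x *m x^T) 0 0.
  by rewrite Ex -scalemxAl mxE.
have yy : (y *m y^T) 0 0 = (x *m x^T) 0 0.
  rewrite !mxE (reindex_inj (@perm_inj _ s)) /=.
  by apply: eq_bigr => j _; rewrite !mxE permK.
have quadT : (x *m (AP + D) *m x^T) 0 0 <= (y *m AT *m y^T) 0 0.
  rewrite [in leLHS]mxE [leRHS]mxE [leRHS](reindex_inj (@perm_inj _ s)) /=.
  apply: ler_sum => i _; rewrite yAE 2![_^T _ _]mxE yE ler_pM2r // mxE.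
  by apply: ler_sum => j _; rewrite ler_pM2l // mxE entry.
(* The form equals twice [e x_(p-1) (x_c - x_p) + (b - a) (x_(c-1) x_c - x_p x_(p+1))]; unimodality
   applies since [p <= r] gives [p <= c <= m - p]. *)
have quadD : 0 <= (x *m D *m x^T) 0 0.
  have -> : (x *m D *m x^T) 0 0 =
     e * ((x *m edge_mx p.-1 c *m x^T) 0 0 - (x *m edge_mx p.-1 p *m x^T) 0 0) +
     (b - a) * ((x *m edge_mx c.-1 c *m x^T) 0 0 - (x *m edge_mx p p.+1 *m x^T) 0 0).
    rewrite /D mulmxDr mulmxDl -!scalemxAr -!scalemxAl !mulmxBr !mulmxBl.
    by rewrite !mxE.
  rewrite !quad_edge -!mulrBr; apply: addr_ge0.
    apply: mulr_ge0; first exact: ltW.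
    by rewrite !mulr_ge0 ?subr_ge0 ?monox // ltW.
  rewrite !mulr_ge0 ?subr_ge0 //.
  (* For [p = r] the reflection exchanges [c] with [p] and [c.-1] with [p.+1], so the two products
     are equal; for [p < r] unimodality also compares [x_(p+1)] with [x_c]. *)
  have [rp|rp] := eqVneq p r.
    have [Ec Ec1] := eq_pr rp.
    by rewrite -(symx c) // -(symx c.-1) // Ec Ec1 mulrC.
  have pc1 : (p.+1 <= c <= m - p.+1)%N by apply: lt_pr.
  by rewrite [leRHS]mulrC mulrC ler_pM ?(ltW (x_gt0 _)) ?monox // mulrC monox.
have le_lam : lam * (y *m y^T) 0 0 <= (y *m AT *m y^T) 0 0.
  apply: le_trans quadT; rewrite mulmxDr mulmxDl [leRHS]mxE quadP yy.
  by rewrite lerDl.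
have symT := weighted_adj_sym T wf.
rewrite lt_neqAle (spectral_radius_ge symT _ y0 le_lam) // andbT.
(* Equality would make the transported Perron vector an eigenvector of the spider. Its equation at
   the centre contradicts the one of the path, since the centre has gained the neighbour [v_(p-1)]
   and no entry of its column has decreased. *)
apply/eqP => Erho; rewrite Erho in le_lam.
have := rayleigh_eq symT (ltn0Sn m) le_lam => /rowP/(_ (s (ord c))).
rewrite yAE [RHS]mxE yE -Erho => EcT; have /rowP/(_ (ord c)) := Ex.
rewrite mxE [RHS]mxE => EcP.
have col i : AP i (ord c) <= AT (s i) (s (ord c)).
  have [ic|/negbTE nic] := boolP (path_rel i (ord c)); last first.
    by rewrite [leLHS]mxE /= nic weighted_adj_ge0.
  apply: le_trans (path_weight_le wf _ _) _; apply: le_trans le_b13 _.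
  have Tic : T (s i) (s (ord c)).
    move: ic; rewrite /path_rel inordK; last by rewrite ltnW.
    case/orP => /eqP ic.
      have ii : (i < m)%N by rewrite -ltnS ic ltnW.
      by have := Tedge ii; rewrite inord_val ic => /(_ cp').
    by have := Tedge cm cp; rewrite ic inord_val (adj_sym T).
  exact: (weighted_adj_ge wf Tic (l1 := 1) (l2 := 3) (degree_gt0 Tic) spider_deg3).
suff : \sum_i x 0 i * AP i (ord c) < \sum_i x 0 i * AT (s i) (s (ord c)).
  by rewrite EcT EcP ltxx.
apply: (ltr_sum_at (i0 := ord p.-1)) => [i|]; first by rewrite ler_pM2l ?col.
rewrite ltr_pM2l; last exact: x_gt0.
rewrite AP0; exact: weighted_adj_gt0.
Qed.

End Spider.

(** * Trees other than spiders *)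

Section Fat.
Variables (R : realType) (f : R -> R -> R).
Hypothesis wf : restricted_weight f.
Local Notation b := (f 2 2).

(** The Perron vector of [H], pulled back along the isomorphism, serves as test vector on [G]. *)
Lemma isomorphic_spectral_radius_ge n (G H : sgraph n) :
  connected_graph H -> isomorphic G H ->
  spectral_radius (weighted_adj f H) <= spectral_radius (weighted_adj f G).
Proof.
move=> cH [s GH]; have [n_gt0 _] := cH.
have degE i : degree G i = degree H (s i).
  rewrite /degree -(card_imset _ (@perm_inj _ s)); apply: eq_card => j.
  rewrite !inE; apply/imsetP/idP => [[k + ->]|Hj].
    by rewrite inE GH.
  by exists ((s^-1)%g j); rewrite ?inE -?GH permKV.
have AE i j : weighted_adj f G i j = weighted_adj f H (s i) (s j).
  by rewrite !mxE GH !degE.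
have [x [x_gt0 Ex]] := perron_graph wf cH.
have symG := weighted_adj_sym G wf.
apply: (spectral_radius_ge_sub (x := \row_i x 0 (s i)) symG n_gt0).
- by apply/rV0Pn; exists (Ordinal n_gt0); rewrite mxE gt_eqF.
- by move=> i; rewrite mxE ltW.
move=> i; rewrite [in leLHS]mxE [leRHS]mxE.
have /rowP/(_ (s i)) := Ex; rewrite mxE [RHS]mxE => <-.
rewrite (reindex_inj (@perm_inj _ s)) /=; apply: ler_sum => j _.
by rewrite AE mxE.
Qed.

(* The vector [2] on [S], [1] on the other neighbours of [S] satisfies
   [A y >= 2 b y]. *)
Lemma fat_set_spectral_radius n (T : sgraph n) (S : {set 'I_n}) :
  S != finset.set0 ->
  (forall v, v \in S -> (4 <= degree T v + #|[set u in S | T v u]|)%N) ->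
  2 * b <= spectral_radius (weighted_adj f T).
Proof.
move=> /finset.set0Pn[v0 v0S] fat.
have b_gt0 : 0 < b by apply: weight_gt0 => //; lra.
have sub v : [set u in S | T v u] \subset [set u | T v u].
  by apply/fintype.subsetP => u; rewrite !inE => /andP[].
have deg2 v : v \in S -> (2 <= degree T v)%N.
  by move=> /fat; have := subset_leq_card (sub v); rewrite -/(degree T v); lia.
have wS v u : v \in S -> T v u -> b <= weighted_adj f T v u.
  move=> vS Tvu; have [uS|uS] := boolP (u \in S).
    exact: (weighted_adj_ge wf Tvu (l1 := 2) (l2 := 2) (deg2 _ vS) (deg2 _ uS)).
  (* A neighbour [u] outside [S] makes the second summand in [fat] strictly smaller than the degree,
     so the degree is at least 3. *)
  have deg3 : (3 <= degree T v)%N.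
    have : (#|[set u in S | T v u]| < degree T v)%N.
      apply: proper_card; apply/properP; split; first exact: sub.
      by exists u; rewrite !inE ?Tvu ?andbT // (negbTE uS).
    by have := fat v vS; lia.
  have degu : (1 <= degree T u)%N by apply: (degree_gt0 (v := v)); rewrite adj_sym.
  apply: le_trans (weight22_le13 wf) _; rewrite weight_sym //; last lra.
  exact: (weighted_adj_ge wf Tvu (l1 := 3) (l2 := 1) deg3 degu).
pose y : 'rV[R]_n := \row_v
  (if v \in S then 2 else if [exists u in S, T u v] then 1 else 0).
have y_ge0 v : 0 <= y 0 v by rewrite mxE; do 2?case: ifP.
have symT := weighted_adj_sym T wf.
have n_gt0 : (0 < n)%N by apply: leq_trans (ltn_ord v0).
have terms_ge0 v u : 0 <= y 0 u * weighted_adj f T u v.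
  by rewrite mulr_ge0 ?weighted_adj_ge0.
apply: (spectral_radius_ge_sub (x := y) symT n_gt0) => //.
  by apply/rV0Pn; exists v0; rewrite mxE v0S pnatr_eq0.
move=> v; rewrite [leRHS]mxE [y 0 v]mxE.
have [vS|vS] := boolP (v \in S); last first.
  case: ifP => [/existsP[u /andP[uS Tuv]]|_]; last by rewrite mulr0 sumr_ge0.
  rewrite (bigD1 u) //= mulr1 -[leLHS]addr0 lerD ?sumr_ge0 //.
  by rewrite mxE uS ler_pM2l // wS.
(* Each neighbour of [v] counts once, and once more if it lies in [S]; the total is at least 4,
   twice the value 2 at [v]. *)
apply: (@le_trans _ _ (\sum_u ((T v u)%:R * b + ((u \in S) && T v u)%:R * b))).
  rewrite big_split /= -!mulr_suml -!natr_sum.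
  have -> : (\sum_(u < n) T v u = degree T v)%N.
    rewrite /degree -sum1_card [RHS]big_mkcond /=.
    by apply: eq_bigr => u _; rewrite inE; case: (T v u).
  have -> : (\sum_(u < n) ((u \in S) && T v u) = #|[set u in S | T v u]|)%N.
    rewrite -sum1_card [RHS]big_mkcond /=.
    by apply: eq_bigr => u _; rewrite inE; case: (_ && _).
  rewrite -mulrDl -natrD mulrAC ler_pM2r // -natrM ler_nat.
  exact: fat.
apply: ler_sum => u _; have [Tvu|Tvu] := boolP (T v u); last first.
  by rewrite andbF !mul0r addr0.
have bA : b <= weighted_adj f T u v by rewrite -symT mxE wS.
rewrite andbT mul1r mxE; case: ifP => uS.
  by rewrite mul1r; lra.
rewrite mul0r addr0; case: ifP => [_|/existsP[]]; first by rewrite mul1r.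
by exists v; rewrite vS.
Qed.

End Fat.

(** * Recognizing paths and spiders among trees *)

Section Combinatorics.
Variables (n : nat) (T : sgraph n).
Hypothesis treeT : is_tree T.

(** A simple path in a tree is induced: a chord from position [i] and the rest of the path after [i]
    would fork and meet again. *)
Lemma uniq_path_exact c (L : seq 'I_n) i j : uniq L -> sorted T L ->
  (i < size L)%N -> (j < size L)%N ->
  T (nth c L i) (nth c L j) = (i.+1 == j) || (j.+1 == i).
Proof.
move=> uL sL; wlog ij : i j / (i <= j)%N => [hw iL jL|].
  have [/hw->//|/ltnW/hw h] := leqP i j.
  by rewrite adj_sym h // orbC.
move=> iL jL; move: ij; rewrite leq_eqVlt => /orP[/eqP->|].
  by rewrite adj_irr; lia.
rewrite leq_eqVlt => /orP[/eqP ij|ij].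
  rewrite ij eqxx /= -ij; move/(sortedP c): sL; apply.
  by rewrite ij.
have -> : (i.+1 == j) || (j.+1 == i) = false by lia.
apply/negP => Tij.
have Ed := drop_nth c iL.
have := drop_sorted i sL; rewrite Ed /= => ps.
have := drop_uniq i uL; rewrite Ed => us.
have [_ acT] := treeT.
have iL1 : (i.+1 < size L)%N by exact: ltn_trans ij jL.
have := @acyclic_fork _ T (nth c L i) _ [:: nth c L j] acT ps _ us.
rewrite /= Tij orbF inE (drop_nth c iL1) /= !nth_uniq //.
have -> : (i == j) = false by lia.
have -> : (i.+1 == j) = false by lia.
move=> /(_ isT isT isT); rewrite -(drop_nth c iL1) => /negP; apply.
rewrite -[X in nth c L X](subnKC (ltnW ij)) -nth_drop mem_nth // size_drop.
by rewrite ltn_sub2r.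
Qed.

Lemma tree_degree2_isomorphic_path :
  (forall v, (degree T v <= 2)%N) -> isomorphic T (path_graph n).
Proof.
move=> deg2; have [cT acT] := treeT; have [n_gt0 _] := cT.
pose c := Ordinal n_gt0.
have [l [/= pl ul mxl]] := @maximal_path _ T c [::] isT isT.
(* A path maximal at its end [z] is reversed and extended beyond [c], so that it becomes maximal at
   both ends and hence spans the tree. *)
pose z := last c l; pose l' := rev (belast c l).
have Ezl : z :: l' = rev (c :: l) by rewrite [c :: l]lastI rev_rcons.
have pl' : path T z l'.
  by rewrite rev_path (eq_path (e' := T)) // => x y; rewrite adj_sym.
have ul' : uniq (z :: l') by rewrite Ezl rev_uniq.
have [t [pt ut mxt]] := maximal_path pl' ul'.
set L := z :: l' ++ t in ut mxt.
have clL v u : v \in L -> T v u -> u \in L.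
  rewrite inE => /orP[/eqP-> /mxl ucl|vl Tvu].
    by rewrite /L -cat_cons Ezl mem_cat mem_rev ucl.
  exact: maximal_path_closed pt ut mxt vl (deg2 v) Tvu.
have sL : size L = n by apply: maximal_path_cover cT clL (mem_head _ _) ut.
have sgL (i : 'I_n) : (i < size L)%N by rewrite sL.
have inj : injective (fun i : 'I_n => nth c L i).
  by move=> i j /eqP; rewrite nth_uniq // => /eqP/ord_inj.
exists ((perm inj)^-1)%g => i j.
rewrite -{2}(permKV (perm inj) i) -{2}(permKV (perm inj) j) !(permE inj).
by rewrite uniq_path_exact.
Qed.

End Combinatorics.

(** Take for [S] a simple path from [c] to [c']: its ends count at least 3 + 1, its inner vertices
    at least 2 + 2. *)
Lemma fat_path n (T : sgraph n) c c' : connected_graph T -> c != c' ->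
  (3 <= degree T c)%N -> (3 <= degree T c')%N ->
  exists2 S : {set 'I_n}, S != finset.set0 &
    forall v, v \in S -> (4 <= degree T v + #|[set u in S | T v u]|)%N.
Proof.
move=> [_ cT] cc' dc dc'; have /connectP[p0 p0T Ec'] := cT c c'.
case: (shortenP p0T) Ec' => p pT up _ {p0 p0T} Ec'.
have [S memS] : exists S : {set 'I_n}, S =i c :: p.
  by exists [set v in c :: p] => v; rewrite inE.
exists S; first by apply/finset.set0Pn; exists c; rewrite memS mem_head.
have card_ge v s : uniq s -> all (fun u => (u \in c :: p) && T v u) s ->
    (size s <= #|[set u in S | T v u]|)%N.
  move=> us /allP sP; rewrite cardE; apply: uniq_leq_size => // u /sP.
  by rewrite mem_enum finset.in_set memS.
move=> v; rewrite memS => vp {memS}.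
have [vc|vc] := eqVneq v c.
  rewrite vc; case: p pT up Ec' card_ge {vp} => [|y p] pT up Ec' card_ge.
    by rewrite Ec' /= eqxx in cc'.
  have /andP[Tcy _] := pT.
  have := @card_ge c [:: y] isT; rewrite /= !inE eqxx orbT Tcy => /(_ isT).
  by move: dc; lia.
have {vc} vp' : v \in p by move: vp; rewrite inE (negbTE vc).
case/splitPr: vp' pT up Ec' card_ge {vp} => p1 p2 pT up Ec' card_ge.
have prev_in : last c p1 \in c :: p1 ++ v :: p2.
  by rewrite -cat_cons mem_cat mem_last.
case: p2 pT up Ec' card_ge prev_in => [|q p2] pT up Ec' card_ge prev_in.
  rewrite last_cat /= in Ec'; rewrite Ec' in dc'.
  move: pT; rewrite cat_path /= andbT => /andP[_ Tpv].
  have := @card_ge v [:: last c p1] isT; rewrite /= prev_in adj_sym Tpv => /(_ isT).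
  by move: dc'; lia.
move: pT; rewrite cat_path /= => /and4P[_ Tpv Tvq _].
have neq : last c p1 != q.
  apply: contraTneq up => Eq; rewrite -cat_cons cat_uniq negb_and negb_and negbK.
  apply/orP; right; apply/orP; left; apply/hasP; exists q; last by rewrite /= -Eq mem_last.
  by rewrite !inE eqxx orbT.
have us2 : uniq [:: last c p1; q] by rewrite /= inE neq.
have all2 : all (fun u => (u \in c :: p1 ++ v :: q :: p2) && T v u) [:: last c p1; q].
  rewrite /= prev_in Tvq adj_sym Tpv /= !inE mem_cat !inE eqxx !orbT.
  by [].
have c2 := card_ge v _ us2 all2.
have : (2 <= degree T v)%N.
  by apply: (size_le_degree us2); rewrite /= Tvq adj_sym Tpv.
by move: c2; rewrite /=; lia.
Qed.

Section Legs.
Variables (m : nat) (T : sgraph m.+1) (c : 'I_m.+1).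
Hypothesis treeT : is_tree T.

Let is_leg l := [/\ path T c l, uniq (c :: l) & l != [::]].

(** The list [L] runs from the tip of [l1] inwards, then from the tip of [l2] inwards to [c], then
    out along [l3]. The legs are disjoint by [acyclic_fork], and closure under adjacency makes [L]
    an enumeration of all vertices, which defines [s]. *)
Lemma legs_spider l1 l2 l3 : is_leg l1 -> is_leg l2 -> is_leg l3 ->
  head c l1 != head c l2 -> head c l1 != head c l3 -> head c l2 != head c l3 ->
  (forall v u, v \in rev l1 ++ rev l2 ++ c :: l3 -> T v u ->
     u \in rev l1 ++ rev l2 ++ c :: l3) ->
  exists s : 'S_m.+1,
  [/\ m = (size l1 + size l2 + size l3)%N,
      forall k, (k < m)%N -> k.+1 != size l1 -> T (s (inord k)) (s (inord k.+1)) &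
      T (s (inord (size l1).-1)) (s (inord (size l1 + size l2)))].
Proof.
move=> [p1 u1 n1] [p2 u2 n2] [p3 u3 n3] h12 h13 h23 clL.
have [cT acT] := treeT.
set L := rev l1 ++ rev l2 ++ c :: l3 in clL *.
have uL : uniq L.
  move: (u1) (u2) (u3) => /= /andP[c1 ul1] /andP[c2 ul2] /andP[c3 ul3].
  rewrite !cat_uniq !rev_uniq ul1 ul2 /= c3 ul3 !andbT mem_rev negb_or c2 /=.
  rewrite has_cat negb_or has_rev /= mem_rev negb_or c1 /=.
  have r (s t : seq 'I_m.+1) : has [in rev s] t = has (mem s) t.
    by apply: eq_has => x; rewrite /= mem_rev.
  rewrite !r (acyclic_fork acT p1 p2 u1 u2) // (acyclic_fork acT p1 p3 u1 u3) //.
  by rewrite (acyclic_fork acT p2 p3 u2 u3).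
have cL : c \in L by rewrite !mem_cat mem_head !orbT.
have sL : size L = m.+1 by apply: maximal_path_cover cT clL cL uL.
have Em : m = (size l1 + size l2 + size l3)%N.
  by move: sL; rewrite !size_cat /= !size_rev; clear; lia.
have inj : injective (fun i : 'I_m.+1 => nth c L i).
  by move=> i j /eqP; rewrite nth_uniq ?sL // => /eqP/ord_inj.
have sE k : (k < m.+1)%N -> perm inj (inord k) = nth c L k.
  by move=> km; rewrite permE inordK.
have symT (x : 'I_m.+1) s : path (fun y z => T z y) x s = path T x s.
  by apply: eq_path => y z; rewrite adj_sym.
have sort1 : sorted T (rev l1).
  rewrite rev_sorted; case: (l1) p1 => //= x l; rewrite symT.
  by case/andP.
have sort2 : sorted T (rev l2 ++ c :: l3).
  by rewrite sorted_cat_cons p3 andbT -rev_cons rev_sorted /= symT.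
have l1_gt0 : (0 < size l1)%N by case: (l1) n1.
exists (perm inj); split=> // [k km k1|].
  rewrite !sE ?ltnS //; last exact: ltnW.
  rewrite /L !(nth_cat c (rev l1)) size_rev.
  have [lt|ge] := ltnP k.+1 (size l1).
    rewrite (ltnW lt); move/(sortedP c): sort1; apply.
    by rewrite size_rev.
  have kl : (size l1 <= k)%N by rewrite -ltnS ltn_neqAle eq_sym k1.
  rewrite ltnNge kl /= subSn //; move/(sortedP c): sort2; apply.
  by rewrite size_cat size_rev /=; move: Em km kl; clear; lia.
have [i1 i2] : ((size l1).-1 < m.+1)%N /\ (size l1 + size l2 < m.+1)%N.
  by move: Em; clear; lia.
rewrite !sE //.
rewrite /L !(nth_cat c (rev l1)) size_rev.
rewrite (ltn_predL (size l1)) l1_gt0 ltnNge leq_addr /=.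
rewrite addKn nth_cat size_rev ltnn subnn /= nth_rev ?prednK ?subnn //.
by rewrite nth0 adj_sym; case: (l1) n1 p1 => //= x l _ /andP[].
Qed.

End Legs.

(** * The path minimizes the spectral radius *)

Section PathMin.
Variables (R : realType) (f : R -> R -> R).
Hypothesis wf : restricted_weight f.

Lemma nonpath_spectral_radius n (T : sgraph n) c : is_tree T ->
  (3 <= degree T c)%N ->
  spectral_radius (weighted_adj f (path_graph n)) < spectral_radius (weighted_adj f T).
Proof.
move=> treeT dc; have [cT acT] := treeT; have [n_gt0 _] := cT.
have lt2b := path_spectral_radius_lt wf n_gt0.
have [[S S0 fat]|nofat] := pselect (exists2 S : {set 'I_n}, S != finset.set0 &
    forall v, v \in S -> (4 <= degree T v + #|[set u in S | T v u]|)%N).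
  exact: lt_le_trans lt2b (fat_set_spectral_radius wf S0 fat).
have deg2 v : v != c -> (degree T v <= 2)%N.
  move=> vc; rewrite leqNgt; apply/negP => dv; apply: nofat.
  by apply: fat_path cT _ dc dv; rewrite eq_sym.
have deg3 : degree T c = 3.
  apply/eqP; rewrite eqn_leq dc andbT leqNgt; apply/negP => d4; apply: nofat.
  (* A vertex of degree 4 alone is such a set, the count being 4 + 0. *)
  exists [set c]; first by apply/finset.set0Pn; exists c; rewrite inE.
  by move=> v; rewrite inE => /eqP->; rewrite (leq_trans d4) ?leq_addr.
case: n T c treeT cT acT n_gt0 lt2b dc nofat deg2 deg3 => // m T c treeT cT acT _ _ _ _ deg2 deg3.
have [w1 [w2 [w3 [uw Ew]]]] : exists w1 w2 w3, uniq [:: w1; w2; w3] /\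
    forall u, T c u = (u \in [:: w1; w2; w3]).
  move: deg3; rewrite /degree cardE.
  have := enum_uniq [set j | T c j]; have := mem_enum [set j | T c j].
  case: (enum _) => [|w1 [|w2 [|w3 [|? ?]]]] //= Ew uw _.
  by exists w1, w2, w3; split=> // u; rewrite Ew inE.
pose maximal l := forall v u, v \in l -> T v u -> u \in c :: l.
have leg w : T c w -> exists t, [/\ path T c (w :: t), uniq (c :: w :: t) & maximal (w :: t)].
  move=> Tcw; have cw : c != w by apply: contraTneq Tcw => ->; rewrite adj_irr.
  have pw : path T c [:: w] by rewrite /= Tcw.
  have uw' : uniq [:: c; w] by rewrite /= inE cw.
  have [t [pt ut mxt]] := maximal_path pw uw'.
  exists t; split=> // v u vl; apply: (maximal_path_closed pt ut mxt vl); apply: deg2.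
  by apply: contraTneq vl => ->; have /andP[] := ut.
have [Tw1 Tw2 Tw3] : [/\ T c w1, T c w2 & T c w3] by rewrite !Ew !inE !eqxx !orbT.
move: uw; rewrite /= !inE negb_or andbT => /andP[/andP[w12 w13] w23].
have [t1 [p1 u1 cl1]] := leg _ Tw1; have [t2 [p2 u2 cl2]] := leg _ Tw2.
have [t3 [p3 u3 cl3]] := leg _ Tw3.
(* Stated for legs in any order, so that the first and the third can be exchanged to get
   [size l1 <= size l3]. *)
have key l1 l2 l3 : path T c l1 -> path T c l2 -> path T c l3 ->
    uniq (c :: l1) -> uniq (c :: l2) -> uniq (c :: l3) ->
    maximal l1 -> maximal l2 -> maximal l3 ->
    l1 != [::] -> l2 != [::] -> l3 != [::] ->
    head c l1 != head c l2 -> head c l1 != head c l3 -> head c l2 != head c l3 ->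
    (forall u, T c u -> [|| u \in l1, u \in l2 | u \in l3]) ->
    (size l1 <= size l3)%N ->
    spectral_radius (weighted_adj f (path_graph m.+1)) <
      spectral_radius (weighted_adj f T).
  move=> q1 q2 q3 v1 v2 v3 mx1 mx2 mx3 n1 n2 n3 h12 h13 h23 nbr le13.
  have memL u : (u \in rev l1 ++ rev l2 ++ c :: l3) =
      (u == c) || [|| u \in l1, u \in l2 | u \in l3].
    by rewrite !mem_cat !mem_rev inE; do !case: (_ \in _); rewrite ?orbT.
  have [||||||| s [Em edges branch]] := @legs_spider m T c treeT l1 l2 l3 => //.
    move=> v u; rewrite !memL => /orP[/eqP->|/or3P[] vl] Tvu.
    - by rewrite nbr ?orbT.
    - by have := mx1 _ _ vl Tvu; rewrite inE => /orP[]->; rewrite ?orbT.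
    - by have := mx2 _ _ vl Tvu; rewrite inE => /orP[]->; rewrite ?orbT.
    - by have := mx3 _ _ vl Tvu; rewrite inE => /orP[]->; rewrite ?orbT.
  apply: (spider_gt wf _ _ le13 Em edges branch).
  - by case: (l1) n1.
  - by case: (l2) n2.
have [le13|/ltnW le31] := leqP (size (w1 :: t1)) (size (w3 :: t3)).
  apply: (key _ _ _ p1 p2 p3) le13 => // u; rewrite Ew !inE.
  by case/or3P => ->; rewrite ?orbT.
apply: (key _ _ _ p3 p2 p1) le31; rewrite //= 1?eq_sym // => u; rewrite Ew !inE.
by case/or3P => ->; rewrite ?orbT.
Qed.

Lemma path_spectral_radius_min n (T : sgraph n) : is_tree T ->
  spectral_radius (weighted_adj f (path_graph n)) <= spectral_radius (weighted_adj f T)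
  /\ (spectral_radius (weighted_adj f T) =
      spectral_radius (weighted_adj f (path_graph n)) -> isomorphic T (path_graph n)).
Proof.
move=> treeT; have [[n_gt0 _] _] := treeT.
have [/existsP[c dc]|/existsPn deg2] := boolP [exists c, (2 < degree T c)%N].
  have lt := nonpath_spectral_radius treeT dc.
  by split; [exact: ltW | move=> E; rewrite E ltxx in lt].
have iso : isomorphic T (path_graph n).
  by apply: tree_degree2_isomorphic_path => // v; rewrite leqNgt deg2.
split=> [|_]; last exact: iso.
exact: (isomorphic_spectral_radius_ge wf (path_tree n_gt0).1 iso).
Qed.

End PathMin.

Lemma isomorphic_order1 (G H : sgraph 1) : isomorphic G H.
Proof. by exists 1%g => i j; rewrite !ord1 !adj_irr. Qed.

Theorem theorem4p1 (R : realType) (f : R -> R -> R) (n : nat) :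
  restricted_weight f -> (0 < n)%N ->
  [/\ is_tree (path_graph n),
      forall T : sgraph n, is_tree T ->
        spectral_radius (weighted_adj f (path_graph n))
          <= spectral_radius (weighted_adj f T) &
      forall T : sgraph n, is_tree T ->
        spectral_radius (weighted_adj f T)
          = spectral_radius (weighted_adj f (path_graph n)) ->
        isomorphic T (path_graph n)]
  /\
  [/\ is_tree (star_graph n),
      forall T : sgraph n, is_tree T ->
        spectral_radius (weighted_adj f T)
          <= spectral_radius (weighted_adj f (star_graph n)) &
      forall T : sgraph n, is_tree T ->
        spectral_radius (weighted_adj f T)
          = spectral_radius (weighted_adj f (star_graph n)) ->
        isomorphic T (star_graph n)].
Proof.
move=> wf n_gt0; have treeP := path_tree n_gt0; have treeS := star_tree n_gt0.
split; (split; [assumption | move=> T treeT | move=> T treeT]).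
- exact: (path_spectral_radius_min wf treeT).1.
- exact: (path_spectral_radius_min wf treeT).2.
(* The star estimates assume [1 < n]; for [n = 1] all graphs are isomorphic. *)
- case: (ltnP 1 n) => [n1|n1]; first exact: (star_spectral_radius wf treeT n1).1.
  have En : n = 1%N by apply/eqP; rewrite eqn_leq n1.
  subst n; apply: (isomorphic_spectral_radius_ge wf treeT.1).
  exact: isomorphic_order1.
- case: (ltnP 1 n) => [n1|n1]; first exact: (star_spectral_radius wf treeT n1).2.
  have En : n = 1%N by apply/eqP; rewrite eqn_leq n1.
  by subst n => _; exact: isomorphic_order1.
Qed.
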